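(* Let $0<l<\infty$, $\theta\in\mathbb{C}$ with $|\theta|=1$, $\theta\neq-1$, and let $L_\theta$ be the operator defined below. Let $\lambda\in\mathbb{C}\setminus\{0\}$ with $\Delta_\theta(\lambda)\neq0$. Then $\lambda^3$ belongs to the resolvent set of $L_\theta$, and for every $f\in L^2(0,l)$ and $x\in[0,l]$, $$\big((L_\theta-\lambda^3I)^{-1}f\big)(x)=\frac{i}{\lambda^4\Delta_\theta(\lambda)}\Bigg\{\int_0^x s_2(i\lambda(x-t))\,s_2(i\lambda l)f(t)\,dt-\theta\int_x^l s_2(i\lambda(x-t))\,s_2(-i\lambda l)f(t)\,dt$$ $$\qquad+\int_0^l\Big[\theta\,s_2(i\lambda(x-l))\,s_2(-i\lambda t)-s_2(i\lambda x)\,s_2(i\lambda(l-t))\Big]f(t)\,dt\Bigg\}.$$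
   Context: Let $\zeta_m=e^{2\pi i m/3}$, $m=0,1,2$, and let $s_k(z)=\frac13\sum_{m=0}^{2}\zeta_m^{-k}e^{z\zeta_m}$, $k=0,1,2$, be the $3$-hyperbolic functions. For $|\theta|=1$ and $l>0$, the characteristic function is $\Delta_\theta(\lambda)=\lambda^{-2}\big[s_2(i\lambda l)+\theta\,s_2(-i\lambda l)\big]$. $L_\theta$ is the operator in $L^2(0,l)$ given by $L_\theta y=(-i)^3y'''=iy'''$ on the domain of all $y$ with $y,y',y''$ absolutely continuous on $[0,l]$, $y'''\in L^2(0,l)$, and $y(0)=0$, $y'(0)=\theta y'(l)$, $y(l)=0$. *)

(* Defs.v *)
From HB Require Import structures.
From mathcomp Require Import all_boot all_order all_algebra.
From mathcomp Require Import all_classical all_reals all_analysis.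

Set Implicit Arguments.
Unset Strict Implicit.
Unset Printing Implicit Defensive.

Import Order.TTheory GRing.Theory Num.Theory.
From mathcomp.real_closed Require Import complex.
Local Open Scope classical_set_scope.
Local Open Scope ring_scope.

Section Defs.
Variable R : realType.
Local Notation mu := (@lebesgue_measure R).

Definition cI : R[i] := Complex 0 1.

Definition cexp (z : R[i]) : R[i] :=
  Complex (expR (Re z) * cos (Im z)) (expR (Re z) * sin (Im z)).

Definition zeta (m : nat) : R[i] := cexp (Complex 0 (2 * pi * m%:R / 3)).

Definition s3 (k : nat) (z : R[i]) : R[i] :=
  3^-1 * \sum_(m < 3) (zeta m) ^- k * cexp (z * zeta m).

Definition Delta (l : R) (theta lam : R[i]) : R[i] :=
  lam ^- 2 * (s3 2 (cI * lam * l%:C%C) + theta * s3 2 (- (cI * lam * l%:C%C))).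

Definition Icc (a b : R) : set R := [set t | a <= t <= b].

Definition cint (a b : R) (f : R -> R[i]) : R[i] :=
  Complex (\int[mu]_(t in Icc a b) Re (f t)) (\int[mu]_(t in Icc a b) Im (f t)).

Definition sqn (f : R -> R[i]) (t : R) : R := Re (f t) ^+ 2 + Im (f t) ^+ 2.

Definition L2 (l : R) (f : R -> R[i]) : Prop :=
  measurable_fun (Icc 0 l) (fun t => Re (f t)) /\
  measurable_fun (Icc 0 l) (fun t => Im (f t)) /\
  (\int[mu]_(t in Icc 0 l) (sqn f t)%:E < +oo)%E.

Definition ae_eqI (l : R) (f g : R -> R[i]) : Prop :=
  \forall t \ae mu, Icc 0 l t -> f t = g t.

(* Graph of L_theta: y is in the domain of L_theta and h = L_theta y in L^2.
   y1, y2, g play the roles of y', y'', y''': y, y', y'' are absolutely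
   continuous on [0,l] (indefinite integrals of their derivatives) and
   y''' in L^2(0,l); boundary conditions y(0)=0, y'(0)=theta y'(l), y(l)=0;
   L_theta y = (-i)^3 y''' = i y'''. *)
Definition L_graph (l : R) (theta : R[i]) (y h : R -> R[i]) : Prop :=
  exists y1 y2 g : R -> R[i],
    L2 l g /\
    (forall x, 0 <= x <= l ->
       [/\ y2 x = y2 0 + cint 0 x g,
           y1 x = y1 0 + cint 0 x y2 &
           y x = y 0 + cint 0 x y1]) /\
    [/\ y 0 = 0, y1 0 = theta * y1 l & y l = 0] /\
    ae_eqI l h (fun t => cI * g t).

Definition in_resolvent (l : R) (theta mu0 : R[i]) : Prop :=
  [/\ (forall f, L2 l f -> exists y h, L_graph l theta y h /\
          ae_eqI l (fun t => h t - mu0 * y t) f),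
      (forall y h, L_graph l theta y h ->
          ae_eqI l (fun t => h t - mu0 * y t) (fun=> 0) -> ae_eqI l y (fun=> 0)) &
      (exists K : R, forall y h, L_graph l theta y h ->
          (\int[mu]_(t in Icc 0 l) (sqn y t)%:E <=
           K%:E * \int[mu]_(t in Icc 0 l) (sqn (fun s => h s - mu0 * y s) t)%:E)%E)].

End Defs.
Arguments cI {R}.
Arguments zeta {R}.

(* Main.v *)
(* Put q = i lam and w_m = q zeta_m, so that w_m^3 = q^3 = -i lam^3. If
   i y''' - lam^3 y = f, then each v_m = y'' + w_m y' + w_m^2 y solves the first order
   equation v' = w_m v - i f, hence v_m(x) = e^{w_m x} (v_m(0) - i int_0^x e^{-w_m t} f).
   For absolutely continuous functions this rests on the product rule for e^{wx} times
   an indefinite integral, which is Fubini's theorem on a triangle. Inverting the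
   discrete Fourier transform v_m <-> (y, y', y'') expresses y through y'(0), y''(0) and
   int_0^x s_2(q(x - t)) f(t) dt. The boundary conditions are then a 2x2 linear system
   with determinant lam^2 Delta, which is solvable exactly when Delta <> 0; the addition
   theorem of the s_k and s_2(-a) = s_1(a)^2 - s_0(a) s_2(a) bring the solution to the
   stated form. The kernel is bounded, which makes the inverse bounded on L^2. *)

Require Import Defs.
From HB Require Import structures.
From mathcomp Require Import all_boot all_order all_algebra.
From mathcomp Require Import all_classical all_reals all_analysis.
Import Order.TTheory GRing.Theory Num.Theory.
From mathcomp.real_closed Require Import complex.
From mathcomp Require Import ring lra measurable_realfun.
Import numFieldNormedType.Exports.
Set Implicit Arguments.
Unset Strict Implicit.
Unset Printing Implicit Defensive.
Local Open Scope classical_set_scope.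
Local Open Scope ring_scope.

(** * Real Lebesgue integrals over compact intervals, and exchange of order on a triangle *)

Section RealIntegrals.
Context {R : realType}.
Local Notation mu := (@lebesgue_measure R).
Implicit Types (a b c x l : R) (p u v : R -> R).

Lemma IccE a b : Icc a b = [set` `[a, b]].
Proof. by apply/seteqP; split=> t /=; rewrite in_itv. Qed.

Lemma measurable_Icc a b : measurable (Icc a b).
Proof. by rewrite IccE; exact: measurable_itv. Qed.

Lemma mu_Icc a b : a <= b -> mu (Icc a b) = (b - a)%:E.
Proof.
move=> ab; rewrite IccE lebesgue_measure_itv/= lte_fin.
by case: ltgtP ab => // -> _; rewrite subrr.
Qed.

Lemma within_continuous_integrable u a b : {within `[a, b], continuous u} ->
  mu.-integrable (Icc a b) (EFin \o u).
Proof.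
by move=> cu; rewrite IccE; apply: continuous_compact_integrable => //; exact: segment_compact.
Qed.

Lemma continuous_integrable u a b : continuous u ->
  mu.-integrable (Icc a b) (EFin \o u).
Proof.
by move=> cu; apply: within_continuous_integrable; exact: continuous_subspaceT.
Qed.

Lemma within_continuous_bounded u a b : {within `[a, b], continuous u} ->
  exists M : R, forall t, a <= t <= b -> `|u t| <= M.
Proof.
move=> cu.
have [M [_ hM]] := compact_bounded (continuous_compact cu (@segment_compact _ a b)).
exists (M + 1) => t tab; apply: (hM (M + 1)); first by rewrite ltrDl.
by exists t => //=; rewrite in_itv.
Qed.

Lemma integrable_within_continuousM u p a b : {within `[a, b], continuous u} ->
  mu.-integrable (Icc a b) (EFin \o p) ->
  mu.-integrable (Icc a b) (EFin \o (fun t => u t * p t)).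
Proof.
move=> cu ip.
have [M hM] := within_continuous_bounded cu.
apply: (@integrableMr _ _ R mu _ (measurable_Icc a b) u (EFin \o p)) => //.
  by rewrite IccE; apply: subspace_continuous_measurable_fun.
exists M; split; first exact: num_real.
by move=> M' MM' t /hM /le_trans; apply; exact: ltW.
Qed.

Lemma integrable_continuousM u p a b : continuous u ->
  mu.-integrable (Icc a b) (EFin \o p) ->
  mu.-integrable (Icc a b) (EFin \o (fun t => u t * p t)).
Proof.
by move=> cu; apply: integrable_within_continuousM; exact: continuous_subspaceT.
Qed.

Lemma Rintegral_point p a : \int[mu]_(t in Icc a a) p t = 0.
Proof. by rewrite IccE set_itv1 Rintegral_set1. Qed.

Lemma integrable_subIcc p a b c d : c <= a -> b <= d ->
  mu.-integrable (Icc c d) (EFin \o p) -> mu.-integrable (Icc a b) (EFin \o p).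
Proof.
move=> ca bd; apply: integrableS; [exact: measurable_Icc..|].
by move=> t /= /andP[at_ tb]; rewrite /Icc/= (le_trans ca)//= (le_trans tb).
Qed.

Lemma Rintegral_cat p a b c : a <= b -> b <= c ->
  mu.-integrable (Icc a c) (EFin \o p) ->
  \int[mu]_(t in Icc a c) p t =
  \int[mu]_(t in Icc a b) p t + \int[mu]_(t in Icc b c) p t.
Proof.
move=> ab bc ip.
have ibc := @integrable_subIcc p b c a c ab (lexx c) ip.
move: ip ibc; rewrite !IccE => ip ibc.
have := @Rintegral_itvB R p (BLeft a) (BRight c) b ip.
rewrite !bnd_simp => /(_ ab bc).
rewrite -(@Rintegral_itv_obnd_cbnd _ b); last first.
  by apply: integrableS ibc => //; exact: subset_itv_oc_cc.
by move=> <-; rewrite addrC subrK.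
Qed.

Lemma Rintegral_within_continuous p x : 0 <= x ->
  mu.-integrable (Icc 0 x) (EFin \o p) ->
  {within `[0, x], continuous (fun t => \int[mu]_(s in Icc 0 t) p s)}.
Proof.
move=> x0; rewrite IccE => ip; have := parameterized_integral_continuous x0 ip.
by congr ({within _, continuous _}); apply/funext => t; rewrite IccE.
Qed.

(** Both sides are iterated integrals of u(t) p(s) over the triangle 0 <= s <= t <= x, so Fubini
    applies. Only one factor is continuous; the other is merely integrable, as the source of the
    differential equation will be. *)
Lemma Rintegral_swap p u x : continuous u ->
  mu.-integrable (Icc 0 x) (EFin \o p) ->
  \int[mu]_(t in Icc 0 x) (u t * \int[mu]_(s in Icc 0 t) p s) =
  \int[mu]_(s in Icc 0 x) (p s * \int[mu]_(t in Icc s x) u t).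
Proof.
move=> cu ip.
pose D := Icc 0 x.
have mD : measurable D := measurable_Icc 0 x.
have iu : mu.-integrable D (EFin \o u) by exact: continuous_integrable.
pose p' := p \_ D; pose u' := u \_ D.
have ip' : mu.-integrable setT (EFin \o p').
  by have /integrable_mkcond := ip; rewrite restrict_EFin; apply.
have iu' : mu.-integrable setT (EFin \o u').
  by have /integrable_mkcond := iu; rewrite restrict_EFin; apply.
(* [b] is the indicator of the half-plane s <= t. Together with the extensions of [u] and [p] by
   zero outside [D] it cuts out the triangle. *)
pose b (z : R * R) : R := (z.2 <= z.1 :> R)%R%:R.
pose G (z : R * R) : R := u' z.1 * p' z.2.
pose F (z : R * R) : \bar R := (G z * b z)%:E.
have mG : measurable_fun setT G.
  apply: measurable_funM.
  - apply: (measurableT_comp (f := u')) => //.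
    by apply/measurable_EFinP; exact: (measurable_int mu).
  - apply: (measurableT_comp (f := p')) => //.
    by apply/measurable_EFinP; exact: (measurable_int mu).
have mF : measurable_fun setT F.
  apply/measurable_EFinP; apply: measurable_funM => //; rewrite /b.
  have mb : measurable_fun setT (fun z : R * R => z.2 <= z.1 :> R).
    by apply: measurable_fun_ler.
  by apply: (measurableT_comp (f := fun c : bool => c%:R : R)).
(* Tonelli: the iterated integral of |[G]| factors into two finite integrals. [F] is then dominated
   by [G], since [b] takes the values 0 and 1. *)
have iG : ((mu : {sigma_finite_measure set _ -> \bar R}) \x
           (mu : {sigma_finite_measure set _ -> \bar R}))%E.-integrable setT (EFin \o G).
  apply/integrable12ltyP; first exact/measurable_EFinP.
  have -> : (fun t => \int[mu]_s `|(EFin \o G) (t, s)|)%E =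
      (fun t => `|(u' t)%:E| * \int[mu]_s `|(p' s)%:E|)%E.
    apply/funext => t; rewrite -ge0_integralZl//.
      by apply: eq_integral => s _; rewrite /G /= normrM EFinM.
    by apply: measurableT_comp => //; exact: (measurable_int mu).
  have [_ fp] := integrableP _ _ _ ip'.
  have [mu' fu] := integrableP _ _ _ iu'.
  rewrite ge0_integralZr//; last 2 first.
  - by apply: measurableT_comp.
  - exact: integral_ge0.
  by rewrite lte_mul_pinfty// ?integral_ge0// ge0_fin_numE ?integral_ge0.
have iF : ((mu : {sigma_finite_measure set _ -> \bar R}) \x
           (mu : {sigma_finite_measure set _ -> \bar R}))%E.-integrable setT F.
  apply: le_integrable iG => // z _; rewrite /F /= normrM lee_fin ler_piMr//.
  by rewrite /b normr_nat lern1 leq_b1.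
have := Fubini iF.
(* For t in [D], the conditions s in [D] and s <= t leave exactly [0, t]. For fixed s, the same
   computation below leaves [s, x]. *)
have -> : (fun t => \int[mu]_s F (t, s))%E =
    (fun t => (u t * \int[mu]_(s in Icc 0 t) p s)%:E) \_ D.
  apply/funext => t; rewrite patchE; case: ifPn => [|tD]; last first.
    rewrite integral0_eq// => s _.
    by rewrite /F /G /= /u' patchE (negbTE tD) !mul0r.
  rewrite inE => tD; have [t0 tx] := andP tD.
  have ipt : mu.-integrable (Icc 0 t) (EFin \o p).
    by apply: integrable_subIcc ip.
  rewrite EFinM /Rintegral fineK; last first.
    by apply: integrable_fin_num => //; exact: measurable_Icc.
  rewrite -integralZl//; last exact: measurable_Icc.
  rewrite [RHS]integral_mkcond; apply: eq_integral => s _.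
  rewrite /F /G /b /= /u' /p' !patchE mem_set//.
  case: ifPn => sD.
    move: sD; rewrite inE => /andP[s0 sx].
    case: ifPn => [|/negP st].
      by rewrite inE => /andP[_ st]; rewrite st mulr1 EFinM.
    case: leP => st'; last by rewrite mulr0.
    by exfalso; apply: st; rewrite inE /Icc/= s0.
  case: ifPn => [st|_]; last by rewrite mulr0 mul0r.
  exfalso; move/negP: sD; apply; move: st; rewrite inE => /andP[s0 st].
  by rewrite inE /D /Icc /= s0 (le_trans st).
have -> : (fun s => \int[mu]_t F (t, s))%E =
    (fun s => (p s * \int[mu]_(t in Icc s x) u t)%:E) \_ D.
  apply/funext => s; rewrite patchE; case: ifPn => [|sD]; last first.
    rewrite integral0_eq// => t _.
    by rewrite /F /G /= /p' !patchE (negbTE sD) mulr0 mul0r.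
  rewrite inE => sD; have [s0 sx] := andP sD.
  have ius : mu.-integrable (Icc s x) (EFin \o u) by exact: continuous_integrable.
  rewrite EFinM /Rintegral fineK; last first.
    by apply: integrable_fin_num => //; exact: measurable_Icc.
  rewrite -integralZl//; last exact: measurable_Icc.
  rewrite [RHS]integral_mkcond; apply: eq_integral => t _.
  rewrite /F /G /b /= /u' /p' !patchE [s \in D]mem_set//.
  case: ifPn => tD.
    move: tD; rewrite inE => /andP[t0 tx].
    case: ifPn => [|/negP st].
      by rewrite inE => /andP[st _]; rewrite st mulr1 mulrC EFinM.
    case: leP => st'; last by rewrite mulr0.
    by exfalso; apply: st; rewrite inE /Icc/= st'.
  case: ifPn => [st|_]; last by rewrite !mul0r.
  exfalso; move/negP: tD; apply; move: st; rewrite inE => /andP[st tx].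
  by rewrite inE /D /Icc /= tx (le_trans s0).
by rewrite -!integral_mkcond /Rintegral => ->.
Qed.

Lemma integrable_swap p u x : 0 <= x -> continuous u ->
  mu.-integrable (Icc 0 x) (EFin \o p) ->
  mu.-integrable (Icc 0 x) (EFin \o (fun t => u t * \int[mu]_(s in Icc 0 t) p s)) /\
  mu.-integrable (Icc 0 x) (EFin \o (fun s => p s * \int[mu]_(t in Icc s x) u t)).
Proof.
move=> x0 cu ip; split.
  apply: integrable_continuousM => //; apply: within_continuous_integrable.
  exact: Rintegral_within_continuous.
have iu := @continuous_integrable u 0 x cu.
have cU := Rintegral_within_continuous x0 iu.
(* The integral of [u] over [s, x] is [c] minus its primitive at s, hence continuous in s. *)
pose c := \int[mu]_(t in Icc 0 x) u t.
have cc : {within `[0, x], continuous (fun=> c : R)}.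
  by apply: continuous_subspaceT => ?; exact: cvg_cst.
have H1 := integrable_within_continuousM cc ip.
have H2 := integrable_within_continuousM cU ip.
apply: eq_integrable (integrableB _ H1 H2); try exact: measurable_Icc.
move=> s; rewrite inE => /andP[s0 sx].
rewrite /c (Rintegral_cat s0 sx iu) /= -EFinB; congr EFin; ring.
Qed.
End RealIntegrals.

(** * Complex-valued integrals, handled through real and imaginary parts *)

Section ComplexIntegrals.
Context {R : realType}.
Local Notation mu := (@lebesgue_measure R).
Implicit Types (a b c x l : R) (z w : R[i]) (f g k : R -> R[i]).

Lemma ReD z w : Re (z + w) = Re z + Re w. Proof. by case: z w => ? ? []. Qed.
Lemma ImD z w : Im (z + w) = Im z + Im w. Proof. by case: z w => ? ? []. Qed.
Lemma ReM z w : Re (z * w) = Re z * Re w - Im z * Im w.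
Proof. by case: z w => ? ? []. Qed.
Lemma ImM z w : Im (z * w) = Re z * Im w + Im z * Re w.
Proof. by case: z w => ? ? []. Qed.

Lemma ReB z w : Re (z - w) = Re z - Re w. Proof. by case: z w => ? ? []. Qed.
Lemma ImB z w : Im (z - w) = Im z - Im w. Proof. by case: z w => ? ? []. Qed.

Lemma complex_ext z w : Re z = Re w -> Im z = Im w -> z = w.
Proof. by case: z w => ? ? [? ?] /= -> ->. Qed.

(** Integrability, and continuity below, are componentwise to match [cint], which is built from two
    real integrals. *)
Definition cintegrable a b f :=
  mu.-integrable (Icc a b) (EFin \o (fun t => Re (f t))) /\
  mu.-integrable (Icc a b) (EFin \o (fun t => Im (f t))).

Definition ccontinuous f :=
  continuous (fun t => Re (f t)) /\ continuous (fun t => Im (f t)).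

Lemma eq_cint a b f g : (forall t, a <= t <= b -> f t = g t) ->
  cint a b f = cint a b g.
Proof.
move=> fg; rewrite /cint; congr (Complex _ _); apply: eq_Rintegral => t;
  by rewrite inE => tab; rewrite fg.
Qed.

Lemma cint_point a f : cint a a f = 0.
Proof. by rewrite /cint !Rintegral_point. Qed.

Lemma eq_cintegrable a b f g : (forall t, a <= t <= b -> f t = g t) ->
  cintegrable a b f -> cintegrable a b g.
Proof.
by move=> fg [r i]; split; [apply: eq_integrable r|apply: eq_integrable i];
  [exact: measurable_Icc| |exact: measurable_Icc|];
  move=> t; rewrite inE => /fg /= ->.
Qed.

Lemma cintegrable_sub f a b c d : c <= a -> b <= d ->
  cintegrable c d f -> cintegrable a b f.
Proof.
by move=> ca bd [r i]; split; [exact: integrable_subIcc r|exact: integrable_subIcc i].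
Qed.

Lemma cintegrableD a b f g : cintegrable a b f -> cintegrable a b g ->
  cintegrable a b (fun t => f t + g t).
Proof.
move=> [rf i_f] [rg ig]; split.
  apply: eq_integrable (integrableD _ rf rg) => //; try exact: measurable_Icc.
  by move=> t _; rewrite /= ReD EFinD.
apply: eq_integrable (integrableD _ i_f ig) => //; try exact: measurable_Icc.
by move=> t _; rewrite /= ImD EFinD.
Qed.

Lemma cintegrable_contM a b k f : ccontinuous k -> cintegrable a b f ->
  cintegrable a b (fun t => k t * f t).
Proof.
move=> [ck ck'] [rf jf]; have mI := measurable_Icc a b; split.
  have H1 := integrable_continuousM ck rf; have H2 := integrable_continuousM ck' jf.
  apply: eq_integrable (integrableB _ H1 H2) => //.
  by move=> t _; rewrite /= ReM EFinB.
have H1 := integrable_continuousM ck jf; have H2 := integrable_continuousM ck' rf.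
apply: eq_integrable (integrableD _ H1 H2) => //.
by move=> t _; rewrite /= ImM EFinD.
Qed.

Lemma ccontinuous_cst z : ccontinuous (fun=> z).
Proof. by split=> x; exact: cvg_cst. Qed.

Lemma cintegrableZ a b z f : cintegrable a b f -> cintegrable a b (fun t => z * f t).
Proof. by move=> jf; apply: cintegrable_contM => //; exact: ccontinuous_cst. Qed.

Lemma cintegrableB a b f g : cintegrable a b f -> cintegrable a b g ->
  cintegrable a b (fun t => f t - g t).
Proof.
move=> jf jg; have H := cintegrableD jf (cintegrableZ (-1) jg).
apply: eq_cintegrable H => t _.
by rewrite mulN1r.
Qed.

Lemma ccontinuous_integrable a b k : ccontinuous k -> cintegrable a b k.
Proof. by move=> [ck ck']; split; exact: continuous_integrable. Qed.

Lemma ccontinuousD f g : ccontinuous f -> ccontinuous g ->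
  ccontinuous (fun t => f t + g t).
Proof.
move=> [c1 c2] [d1 d2]; split.
  by under [X in continuous X]eq_fun do rewrite ReD; move=> x; apply: cvgD;
    [exact: c1|exact: d1].
by under [X in continuous X]eq_fun do rewrite ImD; move=> x; apply: cvgD;
  [exact: c2|exact: d2].
Qed.

Lemma ccontinuousB f g : ccontinuous f -> ccontinuous g ->
  ccontinuous (fun t => f t - g t).
Proof.
move=> [c1 c2] [d1 d2]; split.
  by under [X in continuous X]eq_fun do rewrite ReB; move=> x; apply: cvgB;
    [exact: c1|exact: d1].
by under [X in continuous X]eq_fun do rewrite ImB; move=> x; apply: cvgB;
  [exact: c2|exact: d2].
Qed.

Lemma ccontinuousM f g : ccontinuous f -> ccontinuous g ->
  ccontinuous (fun t => f t * g t).
Proof.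
move=> [c1 c2] [d1 d2]; split.
  under [X in continuous X]eq_fun do rewrite ReM; move=> x; apply: cvgB; apply: cvgM;
  [exact: c1|exact: d1|exact: c2|exact: d2].
under [X in continuous X]eq_fun do rewrite ImM; move=> x; apply: cvgD; apply: cvgM;
  [exact: c1|exact: d2|exact: c2|exact: d1].
Qed.

Lemma cintD a b f g : cintegrable a b f -> cintegrable a b g ->
  cint a b (fun t => f t + g t) = cint a b f + cint a b g.
Proof.
move=> [rf jf] [rg jg]; have mI := measurable_Icc a b.
apply: complex_ext => /=.
  under eq_Rintegral do rewrite ReD; by rewrite RintegralD.
under eq_Rintegral do rewrite ImD; by rewrite RintegralD.
Qed.

Lemma cintZ a b z f : cintegrable a b f ->
  cint a b (fun t => z * f t) = z * cint a b f.
Proof.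
move=> [rf jf]; have mI := measurable_Icc a b.
have cst u : continuous (fun _ : R => u : R) by move=> x; exact: cvg_cst.
apply: complex_ext; rewrite ?ReM ?ImM /=.
  under eq_Rintegral do rewrite ReM.
  by rewrite RintegralB ?RintegralZl//; apply: integrable_continuousM.
under eq_Rintegral do rewrite ImM.
by rewrite RintegralD ?RintegralZl//; apply: integrable_continuousM.
Qed.

Lemma cintB a b f g : cintegrable a b f -> cintegrable a b g ->
  cint a b (fun t => f t - g t) = cint a b f - cint a b g.
Proof.
move=> jf jg; rewrite -[- cint _ _ g]mulN1r -cintZ// -cintD//; last exact: cintegrableZ.
by apply: eq_cint => t _; rewrite mulN1r.
Qed.

Lemma cint_lin2 a b (z1 z2 : R[i]) f g : cintegrable a b f -> cintegrable a b g ->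
  cint a b (fun t => z1 * f t + z2 * g t) = z1 * cint a b f + z2 * cint a b g.
Proof.
move=> jf jg; have h1 := cintegrableZ z1 jf; have h2 := cintegrableZ z2 jg.
by rewrite (cintD h1 h2) !cintZ.
Qed.

Lemma cint_lin3 a b (z1 z2 z3 : R[i]) f g k :
  cintegrable a b f -> cintegrable a b g -> cintegrable a b k ->
  cintegrable a b (fun t => z1 * f t + z2 * g t + z3 * k t) /\
  cint a b (fun t => z1 * f t + z2 * g t + z3 * k t) =
  z1 * cint a b f + z2 * cint a b g + z3 * cint a b k.
Proof.
move=> jf jg jk.
have h1 := cintegrableZ z1 jf; have h2 := cintegrableZ z2 jg.
have h3 := cintegrableZ z3 jk; have h12 := cintegrableD h1 h2.
split; first exact: cintegrableD.
by rewrite (cintD h12 h3) (cintD h1 h2) !cintZ.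
Qed.

Lemma cint_cat a b c f : a <= b -> b <= c -> cintegrable a c f ->
  cint a c f = cint a b f + cint b c f.
Proof.
move=> ab bc [rf jf]; apply: complex_ext; rewrite ?ReD ?ImD /=; exact: Rintegral_cat.
Qed.

Lemma cintegrable_contM_cint x k f : 0 <= x -> ccontinuous k -> cintegrable 0 x f ->
  cintegrable 0 x (fun t => k t * cint 0 t f).
Proof.
move=> x0 [ck ck'] [rf jf].
have [a1 _] := integrable_swap x0 ck rf.
have [a2 _] := integrable_swap x0 ck' rf.
have [a3 _] := integrable_swap x0 ck jf.
have [a4 _] := integrable_swap x0 ck' jf.
split.
  apply: eq_integrable (integrableB _ a1 a4); try exact: measurable_Icc.
  by move=> t _; rewrite /= ReM EFinB.
apply: eq_integrable (integrableD _ a3 a2); try exact: measurable_Icc.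
by move=> t _; rewrite /= ImM EFinD.
Qed.

Lemma cint_swap x k f : 0 <= x -> ccontinuous k -> cintegrable 0 x f ->
  cint 0 x (fun t => k t * cint 0 t f) = cint 0 x (fun s => f s * cint s x k).
Proof.
move=> x0 [ck ck'] [rf jf]; have mI := measurable_Icc 0 x.
have [a1 b1] := integrable_swap x0 ck rf.
have [a2 b2] := integrable_swap x0 ck' rf.
have [a3 b3] := integrable_swap x0 ck jf.
have [a4 b4] := integrable_swap x0 ck' jf.
apply: complex_ext => /=.
  under eq_Rintegral do rewrite ReM /=.
  rewrite RintegralB// !Rintegral_swap//.
  under [RHS]eq_Rintegral do rewrite ReM /=.
  by rewrite RintegralB.
under eq_Rintegral do rewrite ImM /=.
rewrite RintegralD// !Rintegral_swap// addrC.
under [RHS]eq_Rintegral do rewrite ImM /=.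
by rewrite RintegralD// addrC.
Qed.

End ComplexIntegrals.

(** * The complex exponential and first order linear equations *)

Section ComplexExponential.
Context {R : realType}.
Local Notation mu := (@lebesgue_measure R).
Implicit Types (a b x t : R) (z w : R[i]) (f : R -> R[i]).

Lemma cexpD z w : cexp (z + w) = cexp z * cexp w.
Proof.
rewrite /cexp ReD ImD expRD cosD sinD.
by apply: complex_ext; rewrite ?ReM ?ImM /=; ring.
Qed.

Lemma cexp0 : cexp 0 = 1 :> R[i].
Proof. by rewrite /cexp /= expR0 cos0 sin0 mulr0 mulr1. Qed.

Lemma Rintegral_derive (F u : R -> R) a b : a <= b -> continuous u ->
  (forall t, is_derive t 1 F (u t)) ->
  \int[mu]_(t in Icc a b) u t = F b - F a.
Proof.
rewrite le_eqVlt => /predU1P[->|ab] cu dF.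
  by rewrite Rintegral_point subrr.
have cF : continuous F.
  move=> t; apply/differentiable_continuous/derivable1_diffP.
  by apply: ex_derive.
rewrite /Rintegral IccE (@continuous_FTC2 _ u F)//.
- exact: continuous_subspaceT.
- split.
  + by move=> t _; apply: ex_derive.
  + exact/cvg_at_right_filter/cF.
  + exact/cvg_at_left_filter/cF.
- by move=> t _; rewrite derive1E; apply: derive_val.
Qed.

Definition expw w t := cexp (w * t%:C%C).

Lemma Re_expw w t : Re (expw w t) = expR (Re w * t) * cos (Im w * t).
Proof. by rewrite /expw /cexp /= ReM ImM /= !mulr0 subr0 add0r. Qed.

Lemma Im_expw w t : Im (expw w t) = expR (Re w * t) * sin (Im w * t).
Proof. by rewrite /expw /cexp /= ReM ImM /= !mulr0 subr0 add0r. Qed.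

Lemma is_derive_Re_expw w t :
  is_derive t 1 (fun t => Re (expw w t)) (Re (w * expw w t)).
Proof.
under [X in is_derive _ _ X]eq_fun do rewrite Re_expw.
apply: is_derive_eq.
rewrite ReM Re_expw Im_expw /GRing.scale /=; ring.
Qed.

Lemma is_derive_Im_expw w t :
  is_derive t 1 (fun t => Im (expw w t)) (Im (w * expw w t)).
Proof.
under [X in is_derive _ _ X]eq_fun do rewrite Im_expw.
apply: is_derive_eq.
rewrite ImM Re_expw Im_expw /GRing.scale /=; ring.
Qed.

Lemma expw_continuous w : ccontinuous (expw w).
Proof.
split=> t; apply/differentiable_continuous/derivable1_diffP.
  by have := is_derive_Re_expw w t => h; apply: ex_derive.
by have := is_derive_Im_expw w t => h; apply: ex_derive.
Qed.

(** The factor w stays under the integral, so that w = 0 is no special case. *)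
Lemma cint_expw w a b : a <= b ->
  cint a b (fun t => w * expw w t) = expw w b - expw w a.
Proof.
move=> ab; have [c1 c2] := ccontinuousM (ccontinuous_cst w) (expw_continuous w).
by apply: complex_ext; rewrite ?ReB ?ImB;
  [exact: Rintegral_derive (is_derive_Re_expw w)|
   exact: Rintegral_derive (is_derive_Im_expw w)].
Qed.

Lemma expw0 w : expw w 0 = 1.
Proof. by rewrite /expw mulr0 cexp0. Qed.

Lemma expwN w t : expw (- w) t * expw w t = 1.
Proof. by rewrite /expw -cexpD mulNr addNr cexp0. Qed.

(** Exchanging the order in the double integral leaves the inner integral e^{wx} - e^{ws}; its
    second term cancels against the summand e^{wt} f(t). No differentiability of the primitive of
    [f] enters. *)
Lemma expw_by_parts w x f : 0 <= x -> cintegrable 0 x f ->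
  expw w x * cint 0 x f =
  cint 0 x (fun t => w * expw w t * cint 0 t f + expw w t * f t).
Proof.
move=> x0 jf.
have cE := expw_continuous w; have cwE := ccontinuousM (ccontinuous_cst w) cE.
have jEf := cintegrable_contM cE jf.
rewrite cintD//; last exact: cintegrable_contM_cint.
rewrite cint_swap//.
rewrite (_ : cint 0 x (fun s => f s * _) =
  cint 0 x (fun t => expw w x * f t - expw w t * f t)).
  by rewrite cintB ?cintZ ?subrK//; exact: cintegrableZ.
apply: eq_cint => t /andP[t0 tx]; rewrite cint_expw//; ring.
Qed.

(** The integrating factor e^{-wx} turns v' = w v + f into (e^{-wx} v)' = e^{-wx} f; everything is
    carried out on integral equations. *)
Lemma linear_ode_solution w x f v : 0 <= x ->
  cintegrable 0 x f -> cintegrable 0 x v ->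
  (forall t, 0 <= t <= x -> v t = v 0 + cint 0 t (fun s => w * v s + f s)) ->
  v x = expw w x * (v 0 + cint 0 x (fun t => expw (- w) t * f t)).
Proof.
move=> x0 jf jv ve.
pose e := expw (- w).
have ce : ccontinuous e := expw_continuous (- w).
suff H : e x * v x = v 0 + cint 0 x (fun t => e t * f t).
  by rewrite -H mulrA [_ * e x]mulrC expwN mul1r.
pose g s := w * v s + f s.
have jg : cintegrable 0 x g by apply: cintegrableD => //; exact: cintegrableZ.
rewrite (ve x) ?x0 ?lexx// mulrDr [e x * cint _ _ _](expw_by_parts (- w) x0 jg).
(* The integral equation identifies the primitive of [g] with v(t) - v(0). The terms in v(t) cancel,
   and only v(0) and [f] remain. *)
rewrite (_ : cint 0 x _ = cint 0 x (fun t => (- v 0) * (- w * e t) + e t * f t)).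
  have jwe : cintegrable 0 x (fun t => - w * e t).
    by apply: ccontinuous_integrable; exact: ccontinuousM (ccontinuous_cst _) ce.
  rewrite cintD; [|exact: cintegrableZ|exact: cintegrable_contM].
  rewrite cintZ// cint_expw// expw0 /e; ring.
apply: eq_cint => t /andP[t0 tx].
rewrite (_ : cint 0 t g = v t - v 0); first by rewrite -/e /g; ring.
by rewrite (ve t) ?t0// addrC addKr.
Qed.

(** Converse of the previous lemma: integration by parts against the integrable function e^{-ws}
    f(s) shows that the explicit formula satisfies the integral equation. *)
Lemma linear_ode_exists w x f c : 0 <= x -> cintegrable 0 x f ->
  let v t := expw w t * (c + cint 0 t (fun s => expw (- w) s * f s)) in
  v x = c + cint 0 x (fun s => w * v s + f s).
Proof.
move=> x0 jf v.
have cE := expw_continuous w.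
have jf' := cintegrable_contM (expw_continuous (- w)) jf.
have jwE : cintegrable 0 x (fun t => w * expw w t).
  by apply: ccontinuous_integrable; exact: ccontinuousM (ccontinuous_cst _) cE.
have jwEP : cintegrable 0 x
    (fun t => w * expw w t * cint 0 t (fun s => expw (- w) s * f s)).
  by apply: cintegrable_contM_cint => //; apply: ccontinuousM (ccontinuous_cst _) cE.
rewrite (_ : cint 0 x _ = cint 0 x (fun t => c * (w * expw w t) +
    (w * expw w t * cint 0 t (fun s => expw (- w) s * f s) +
     expw w t * (expw (- w) t * f t)))).
  rewrite cintD; [|exact: cintegrableZ|].
    by rewrite -expw_by_parts// cintZ// cint_expw// expw0 /v; ring.
  by apply: cintegrableD => //; exact: cintegrable_contM.
apply: eq_cint => t _.
have -> : expw w t * (expw (- w) t * f t) = f t.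
  by rewrite mulrA (mulrC (expw w t)) expwN mul1r.
rewrite /v; move: (expw w t) (cint 0 t _) (f t) => e P F; ring.
Qed.

End ComplexExponential.

(** * Cube roots of unity and the 3-hyperbolic functions *)

Section HyperbolicFunctions.
Context {R : realType}.
Implicit Types (t : R) (z w : R[i]).
Local Notation om := (@zeta R 1).

Lemma zeta0 : zeta 0 = 1 :> R[i].
Proof. by rewrite /zeta !mulr0 mul0r [Complex 0 0](_ : _ = 0)// cexp0. Qed.

Lemma zetaD m n : zeta (m + n) = zeta m * zeta n :> R[i].
Proof.
rewrite /zeta -cexpD; congr cexp.
by apply: complex_ext; rewrite ?ReD ?ImD /= ?addr0// natrD mulrDr mulrDl.
Qed.

Lemma zetaE m : zeta m = om ^+ m :> R[i].
Proof.
by elim: m => [|m IH]; [rewrite zeta0 expr0|rewrite -addn1 zetaD IH exprD expr1].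
Qed.

Lemma zeta1_expr3 : om ^+ 3 = 1.
Proof.
have -> : om ^+ 3 = zeta 3.
  by rewrite -[3%N]/(1 + (1 + 1))%N !zetaD; ring.
rewrite /zeta mulfK ?pnatr_eq0// /cexp /= expR0 !mul1r.
by rewrite mulr_natl cos2pi -[pi *+ 2]add0r sinD2pi sin0.
Qed.

(** The imaginary part of [om] is sin(2 pi / 3) > 0, so [om] is not 1 and the factor om - 1 of om^3
    - 1 can be cancelled. The result serves as the rewriting rule by which [ring] and [field] reduce
    polynomials in [om]. *)
Lemma zeta1_sqr : om ^+ 2 = - 1 - om.
Proof.
have om1 : om != 1.
  apply/eqP => /(congr1 (@Im R)) /=.
  rewrite expR0 mul1r mulr1 => /eqP; apply/negP; rewrite gt_eqF//.
  have p0 := pi_gt0 R.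
  by apply: sin_gt0_pi; lra.
apply/eqP; rewrite -subr_eq0.
have : (om - 1) * (om ^+ 2 - (- 1 - om)) = 0.
  by rewrite -[RHS](subrr 1) -{3}zeta1_expr3; ring.
by move=> /eqP; rewrite mulf_eq0 [om - 1 == 0]subr_eq0 (negbTE om1).
Qed.

Lemma zeta2 : zeta 2 = - 1 - om.
Proof. by rewrite -[2%N]/(1 + 1)%N zetaD -zeta1_sqr expr2. Qed.

Lemma zeta1_inv : om^-1 = - 1 - om.
Proof.
have om0 : om != 0.
  apply/eqP => h; have := zeta1_expr3; rewrite h expr0n /= => /eqP.
  by rewrite eq_sym oner_eq0.
by apply: (mulfI om0); rewrite divff//; ring: zeta1_sqr.
Qed.

Lemma zeta2_inv : (zeta 2)^-1 = om.
Proof. by rewrite zeta2 -zeta1_inv invrK. Qed.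

Lemma s3E k z : s3 k z = 3^-1 * (cexp z + om ^- k * cexp (z * om)
   + (zeta 2) ^- k * cexp (z * zeta 2)).
Proof.
by rewrite /s3 !big_ord_recl big_ord0 addr0 /= zeta0 expr1n invr1 mul1r mulr1 addrA.
Qed.

Lemma s3_0E z : s3 0 z = 3^-1 * (cexp z + cexp (z * om) + cexp (z * zeta 2)).
Proof. by rewrite s3E !expr0 invr1 !mul1r. Qed.

Lemma s3_1E z : s3 1 z =
  3^-1 * (cexp z + (- 1 - om) * cexp (z * om) + om * cexp (z * zeta 2)).
Proof. by rewrite s3E !expr1 zeta1_inv zeta2_inv. Qed.

Lemma s3_2E z : s3 2 z =
  3^-1 * (cexp z + om * cexp (z * om) + (- 1 - om) * cexp (z * zeta 2)).
Proof.
rewrite s3E -!exprVn zeta1_inv zeta2_inv zeta1_sqr; congr (_ * (_ + _ * _ + _)).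
by ring: zeta1_sqr.
Qed.

Lemma three_neq0 : (3 : R[i]) != 0. Proof. by rewrite pnatr_eq0. Qed.

Let s3_unfold := (s3_0E, s3_1E, s3_2E).

Lemma s3_addition z w :
  [/\ s3 0 (z + w) = s3 0 z * s3 0 w + s3 1 z * s3 2 w + s3 2 z * s3 1 w,
      s3 1 (z + w) = s3 1 z * s3 0 w + s3 0 z * s3 1 w + s3 2 z * s3 2 w &
      s3 2 (z + w) = s3 2 z * s3 0 w + s3 1 z * s3 1 w + s3 0 z * s3 2 w].
Proof.
have n3 := three_neq0.
rewrite !s3_unfold !mulrDl !cexpD.
move: (cexp z) (cexp w) (cexp (z * om)) (cexp (w * om)) (cexp (z * zeta 2))
  (cexp (w * zeta 2)) => a b c d e f.
by split; field: zeta1_sqr.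
Qed.

(** As 1 + om + om^2 = 0, the number -z is the sum of z om and z om^2; each exponential at -z is
    therefore a product of two exponentials at z. *)
Lemma s3_opp z :
  [/\ s3 0 (- z) = s3 0 z ^+ 2 - s3 1 z * s3 2 z,
      s3 1 (- z) = s3 2 z ^+ 2 - s3 0 z * s3 1 z &
      s3 2 (- z) = s3 1 z ^+ 2 - s3 0 z * s3 2 z].
Proof.
have n3 := three_neq0.
rewrite !s3_unfold.
have -> : - z = z * om + z * zeta 2 by rewrite zeta2; ring.
have -> : (z * om + z * zeta 2) * om = z + z * zeta 2.
  by rewrite zeta2; ring: zeta1_sqr.
have -> : (z * om + z * zeta 2) * zeta 2 = z + z * om.
  by rewrite zeta2; ring: zeta1_sqr.
rewrite !cexpD.
move: (cexp z) (cexp (z * om)) (cexp (z * zeta 2)) => a b c.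
by split; field: zeta1_sqr.
Qed.

(* Expanding [a - b] by the addition theorem leaves 2x2 minors of the circulant matrix
   of the [s3 _ a]; that matrix has determinant 1 and its inverse is built on [- a]. *)
Lemma s3_kernel z a b :
  s3 2 z * (s3 1 a * s3 1 (a - b) - s3 0 a * s3 2 (a - b)) +
  s3 1 z * (s3 1 a * s3 2 (a - b) - s3 2 a * s3 1 (a - b)) =
  s3 2 (- a) * s3 2 (z - b) - s3 2 (z - a) * s3 2 (- b).
Proof.
have [_ _ ->] := s3_addition z (- b).
have [_ _ ->] := s3_addition z (- a).
have [_ -> ->] := s3_addition a (- b).
have [-> -> ->] := s3_opp a.
ring.
Qed.

End HyperbolicFunctions.

(** * Variation of constants for the third order equation *)

Section Duhamel.
Context {R : realType}.
Local Notation mu := (@lebesgue_measure R).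
Local Notation om := (@zeta R 1).
Variables (l : R) (lam : R[i]).
Hypotheses (l0 : 0 < l) (lam0 : lam != 0).
Implicit Types (t x : R) (f g y : R -> R[i]).

Local Notation q := (cI * lam).
Local Notation J k x f := (cint 0 x (fun t => s3 k (q * (x - t)%:C%C) * f t)).
Local Notation w m := (q * zeta m).
Local Notation E m := (expw (q * zeta m)).
Local Notation P m x f := (cint 0 x (fun t => expw (- (q * zeta m)) t * f t)).

Lemma cI_sqr : cI ^+ 2 = -1 :> R[i].
Proof. by apply/eqP; rewrite expr2 eq_complex /=; apply/andP; split; apply/eqP; ring. Qed.

Lemma cI_neq0 : cI != 0 :> R[i].
Proof. by rewrite eq_complex /= oner_eq0 andbF. Qed.

Lemma q_neq0 : q != 0. Proof. by rewrite mulf_neq0// cI_neq0. Qed.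

Lemma cexp_zeta m x t :
  cexp (q * (x - t)%:C%C * zeta m) = E m x * expw (- (q * zeta m)) t.
Proof.
rewrite /expw -cexpD; congr cexp; rewrite (_ : (x - t)%:C%C = x%:C%C - t%:C%C).
  by ring.
by rewrite rmorphB.
Qed.

(** Each exponential in s_k(q(x - t)) separates into a function of x and a function of t, so the
    Duhamel integrals are inverse discrete Fourier transforms of the products E_m P_m. *)
Lemma duhamel_integralE x f : cintegrable 0 x f ->
  J 1 x f = 3^-1 * (E 0 x * P 0 x f + (- 1 - om) * E 1 x * P 1 x f
                    + om * E 2 x * P 2 x f) /\
  J 2 x f = 3^-1 * (E 0 x * P 0 x f + om * E 1 x * P 1 x f
                    + (- 1 - om) * E 2 x * P 2 x f).
Proof.
move=> jf.
have jP m : cintegrable 0 x (fun t => expw (- (q * zeta m)) t * f t).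
  by apply: cintegrable_contM => //; exact: expw_continuous.
have lin a b c : cint 0 x (fun t => 3^-1 * (a * (expw (- (q * zeta 0)) t * f t) +
    b * (expw (- (q * zeta 1)) t * f t) + c * (expw (- (q * zeta 2)) t * f t))) =
    3^-1 * (a * P 0 x f + b * P 1 x f + c * P 2 x f).
  by have [h e] := cint_lin3 a b c (jP 0) (jP 1) (jP 2); rewrite cintZ// e.
have e0 t : cexp (q * (x - t)%:C%C) = E 0 x * expw (- (q * zeta 0)) t.
  by rewrite -cexp_zeta zeta0 mulr1.
split; rewrite -lin; apply: eq_cint => t _;
  rewrite (s3_1E, s3_2E) e0 !cexp_zeta -[LHS]mulrA; congr (3^-1 * _);
  rewrite !mulrDl; congr (_ + _ + _); rewrite -!mulrA//.
Qed.

Lemma s3_expw x :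
  [/\ s3 0 (q * x%:C%C) = 3^-1 * (E 0 x + E 1 x + E 2 x),
      s3 1 (q * x%:C%C) = 3^-1 * (E 0 x + (- 1 - om) * E 1 x + om * E 2 x) &
      s3 2 (q * x%:C%C) = 3^-1 * (E 0 x + om * E 1 x + (- 1 - om) * E 2 x)].
Proof.
have e m : E m x = cexp (q * x%:C%C * zeta m) by rewrite /expw mulrAC.
by rewrite s3_0E s3_1E s3_2E !e zeta0 mulr1.
Qed.

Lemma zeta_expr3 m : zeta m ^+ 3 = 1 :> R[i].
Proof. by rewrite zetaE -exprM mulnC exprM zeta1_expr3 expr1n. Qed.

Lemma cintegrable_primitive x f y : 0 <= x -> cintegrable 0 x f ->
  (forall t, 0 <= t <= x -> y t = y 0 + cint 0 t f) -> cintegrable 0 x y.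
Proof.
move=> x0 jf ye.
have jF := cintegrable_contM_cint x0 (ccontinuous_cst 1) jf.
have jc := ccontinuous_integrable 0 x (ccontinuous_cst (y 0)).
apply: eq_cintegrable (cintegrableD jc jF) => t tx.
by rewrite mul1r -ye.
Qed.

(** The absolute continuity clause of [L_graph], with [f1], [f2], [f3] as successive derivatives of
    [f0]. *)
Definition primitives f0 f1 f2 f3 :=
  forall x, 0 <= x <= l -> [/\ f2 x = f2 0 + cint 0 x f3,
    f1 x = f1 0 + cint 0 x f2 & f0 x = f0 0 + cint 0 x f1].

Lemma primitives_integrable y y1 y2 g : cintegrable 0 l g ->
  primitives y y1 y2 g ->
  [/\ cintegrable 0 l y2, cintegrable 0 l y1 & cintegrable 0 l y].
Proof.
move=> jg prim; have l0' := ltW l0.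
have j2 : cintegrable 0 l y2 by apply: cintegrable_primitive jg _ => // t /prim[].
have j1 : cintegrable 0 l y1 by apply: cintegrable_primitive j2 _ => // t /prim[].
by split=> //; apply: cintegrable_primitive j1 _ => // t /prim[].
Qed.

(* With w = q zeta_m, the combination v_m = y'' + w y' + w^2 y satisfies
   v_m' = w v_m - i f, because w^3 = q^3. *)
Lemma duhamel y y1 y2 g f x : cintegrable 0 l g -> primitives y y1 y2 g ->
  (forall t, g t = - cI * f t + q ^+ 3 * y t) -> 0 <= x <= l ->
  [/\ q ^+ 2 * y x = s3 2 (q * x%:C%C) * y2 0 + q * s3 1 (q * x%:C%C) * y1 0
        + q ^+ 2 * s3 0 (q * x%:C%C) * y 0 - cI * J 2 x f &
      q * y1 x = s3 1 (q * x%:C%C) * y2 0 + q * s3 0 (q * x%:C%C) * y1 0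
        + q ^+ 2 * s3 2 (q * x%:C%C) * y 0 - cI * J 1 x f].
Proof.
move=> jg prim ge /andP[x0 xl].
have [j2 j1 j] := primitives_integrable jg prim.
have sub a : cintegrable 0 l a -> cintegrable 0 x a by exact: cintegrable_sub.
(* Solving the equation for the source gives f = i (g - q^3 y). *)
have jf : cintegrable 0 l f.
  apply: eq_cintegrable (cintegrableZ cI (cintegrableB jg (cintegrableZ (q ^+ 3) j))).
  move=> t _; rewrite ge; ring: cI_sqr.
pose v m t := y2 t + w m * y1 t + w m ^+ 2 * y t.
have vE m : v m x = E m x * (v m 0 - cI * P m x f).
  rewrite (@linear_ode_solution _ (w m) x (fun t => - cI * f t) (v m))//.
  - congr (_ * (_ + _)); rewrite -[- (cI * _)]mulNr -cintZ; last first.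
      by apply: cintegrable_contM; [exact: expw_continuous|exact: sub].
    by apply: eq_cint => t _; rewrite mulrCA.
  - by apply: cintegrableZ; exact: sub.
  - by rewrite /v; repeat first [apply: cintegrableD|apply: cintegrableZ]; exact: sub.
  - move=> t /andP[t0 tx].
    have subt a : cintegrable 0 l a -> cintegrable 0 t a.
      by apply: cintegrable_sub => //; exact: le_trans xl.
    rewrite {1 2}/v; have [-> -> ->] : [/\ y2 t = y2 0 + cint 0 t g, y1 t = y1 0 + cint 0 t y2 &
       y t = y 0 + cint 0 t y1] by apply: prim; rewrite t0 (le_trans tx).
    (* This is v_m' = w_m v_m - i f: the term w_m^3 y from w_m v_m cancels the q^3 y contained in
       [g]. *)
    rewrite (_ : cint 0 t (fun s => w m * v m s + _) =
      cint 0 t (fun s => 1 * g s + w m * y2 s + w m ^+ 2 * y1 s)).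
      have [_ ->] := cint_lin3 1 (w m) (w m ^+ 2) (subt _ jg) (subt _ j2) (subt _ j1).
      ring.
    apply: eq_cint => s _; rewrite ge /v.
    have := zeta_expr3 m; move: (zeta m) (y s) (y1 s) (y2 s) => z a b c z3.
    by ring: z3.
have [-> -> ->] := s3_expw x.
have [-> ->] := duhamel_integralE (sub _ jf).
have n3 := @three_neq0 R.
have z0 := @zeta0 R. have z2 := @zeta2 R.
have os := @zeta1_sqr R.
have := vE 2; have := vE 1; have := vE 0; rewrite /v.
move: (P 0 x f) (P 1 x f) (P 2 x f) (E 0 x) (E 1 x) (E 2 x) => P0 P1 P2 E0 E1 E2.
rewrite z0 z2 !mulr1.
move: (y x) (y1 x) (y2 x) (y 0) (y1 0) (y2 0) => Y Y1 Y2 a b c v0 v1 v2.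
split.
  (* Inverse Fourier transform with weights zeta_m^{-2}, that is 1, om, om^2: the terms in [Y2] and
     [Y1] sum to zero and q^2 [Y] survives. The weights zeta_m^{-1} below isolate q [Y1] in the same
     way. *)
  transitivity (3^-1 * ((Y2 + q * Y1 + q ^+ 2 * Y)
      + om * (Y2 + q * om * Y1 + (q * om) ^+ 2 * Y) +
      (- 1 - om) * (Y2 + q * (- 1 - om) * Y1 + (q * (- 1 - om)) ^+ 2 * Y))).
    by field: os.
  by rewrite v0 v1 v2; field: os.
transitivity (3^-1 * ((Y2 + q * Y1 + q ^+ 2 * Y)
    + (- 1 - om) * (Y2 + q * om * Y1 + (q * om) ^+ 2 * Y) +
    om * (Y2 + q * (- 1 - om) * Y1 + (q * (- 1 - om)) ^+ 2 * Y))).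
  by field: os.
by rewrite v0 v1 v2; field: os.
Qed.

(* Superposition of the solutions v_m = E_m (A + w_m B - i P_m) of v' = w_m v - i f. *)
Lemma duhamel_exists f (A B : R[i]) : cintegrable 0 l f ->
  exists y y1 y2 : R -> R[i],
    [/\ primitives y y1 y2 (fun t => - cI * f t + q ^+ 3 * y t) /\ cintegrable 0 l y,
        y 0 = 0, y1 0 = B & y2 0 = A].
Proof.
move=> jf.
have n3 := @three_neq0 R; have os := @zeta1_sqr R; have nI := cI_neq0.
have z0 := @zeta0 R; have z2 := @zeta2 R.
(* The initial value A + w_m B is y'' + w_m y' + w_m^2 y at 0 for the data y(0) = 0, y'(0) = B,
   y''(0) = A. *)
pose v m t := E m t * (A + w m * B + cint 0 t (fun s => expw (- w m) s * (- cI * f s))).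
have jf' : cintegrable 0 l (fun t => - cI * f t) by exact: cintegrableZ.
have vE m x : 0 <= x <= l ->
    v m x = A + w m * B + cint 0 x (fun s => w m * v m s + - cI * f s).
  move=> /andP[x0 xl]; apply: (@linear_ode_exists _ (w m) x (fun t => - cI * f t)) => //.
  exact: cintegrable_sub jf'.
have v0 m : v m 0 = A + w m * B by rewrite vE ?lexx ?ltW// cint_point addr0.
have jv m : cintegrable 0 l (v m).
  apply: cintegrable_contM; first exact: expw_continuous.
  apply: (@cintegrable_primitive l (fun s => expw (- w m) s * (- cI * f s))).
  - exact: ltW.
  - by apply: cintegrable_contM => //; exact: expw_continuous.
  - by move=> t _; rewrite cint_point addr0.
(* From here only the integral equation, the initial value and the integrability of the v_m
   matter. *)
clearbody v.
pose y t := 3^-1 * q ^- 2 * (v 0 t + om * v 1 t + (- 1 - om) * v 2 t).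
pose y1 t := 3^-1 * q^-1 * (v 0 t + (- 1 - om) * v 1 t + om * v 2 t).
pose y2 t := 3^-1 * (v 0 t + v 1 t + v 2 t).
exists y, y1, y2; split.
- split; last first.
    have [h _] := cint_lin3 (3^-1 * q ^- 2) (3^-1 * q ^- 2 * om)
        (3^-1 * q ^- 2 * (- 1 - om)) (jv 0) (jv 1) (jv 2).
    by apply: eq_cintegrable h => t _; rewrite /y; ring.
  move=> x xl.
  have jx m : cintegrable 0 x (v m).
    by apply: cintegrable_sub (jv m) => //; case/andP: xl.
  have jfx : cintegrable 0 x (fun t => - cI * f t).
    by apply: cintegrable_sub jf' => //; case/andP: xl.
  have V m : v m x = A + w m * B + (w m * cint 0 x (v m) + cint 0 x (fun s => - cI * f s)).
    rewrite vE// cintD; [by rewrite cintZ|exact: cintegrableZ|exact: jfx].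
  have lin a b c := cint_lin3 a b c (jx 0) (jx 1) (jx 2).
  split.
  + rewrite cintD//; last first.
      apply: cintegrableZ; have [h _] := lin (3^-1 * q ^- 2) (3^-1 * q ^- 2 * om)
        (3^-1 * q ^- 2 * (- 1 - om)).
      by apply: eq_cintegrable h => t _; rewrite /y; ring.
    (* q^3 y is the mean of the w_m v_m. Each v_m carries the source with weight 1/3, so y''
       receives it exactly once. *)
    rewrite (_ : cint 0 x (fun t => q ^+ 3 * _) = cint 0 x (fun t =>
       (3^-1 * q) * v 0 t + (3^-1 * q * om) * v 1 t + (3^-1 * q * (- 1 - om)) * v 2 t)).
      rewrite (lin _ _ _).2 /y2 !v0 !V z0 z2.
      by field: os; rewrite ?n3 ?lam0 ?nI.
    by apply: eq_cint => t _; rewrite /y; field: os; rewrite ?n3 ?lam0 ?nI.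
  (* In y' and in y the weights of the v_m sum to zero, so the source cancels. *)
  + rewrite (_ : cint 0 x y2 = cint 0 x (fun t =>
       3^-1 * v 0 t + 3^-1 * v 1 t + 3^-1 * v 2 t)).
      rewrite (lin _ _ _).2 /y1 !v0 !V z0 z2.
      by field: os; rewrite ?n3 ?lam0 ?nI.
    by apply: eq_cint => t _; rewrite /y2; ring.
  + rewrite (_ : cint 0 x y1 = cint 0 x (fun t => (3^-1 * q^-1) * v 0 t +
       (3^-1 * q^-1 * (- 1 - om)) * v 1 t + (3^-1 * q^-1 * om) * v 2 t)).
      rewrite (lin _ _ _).2 /y !v0 !V z0 z2.
      by field: os; rewrite ?n3 ?lam0 ?nI.
    by apply: eq_cint => t _; rewrite /y1; ring.
- by rewrite /y !v0 z0 z2; field: os; rewrite ?n3 ?lam0 ?nI.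
- by rewrite /y1 !v0 z0 z2; field: os; rewrite ?n3 ?lam0 ?nI.
- by rewrite /y2 !v0 z0 z2; field: os; rewrite ?n3 ?lam0 ?nI.
Qed.

End Duhamel.

(** * Square integrable functions and norm estimates *)

Section SquareIntegrable.
Context {R : realType}.
Local Notation mu := (@lebesgue_measure R).
Implicit Types (a b c x l : R) (z : R[i]) (f g k y : R -> R[i]).

(* [g] may be nonmeasurable, as the [h] of [L_graph] is fixed only almost everywhere;
   its integral is still the supremum over the simple functions below it. *)
Lemma ge0_ae_le_integral (D : set R) (f g : R -> R) : measurable D ->
  measurable_fun D f -> (forall x, D x -> 0 <= f x) -> (forall x, D x -> 0 <= g x) ->
  (\forall t \ae mu, D t -> f t = g t) ->
  (\int[mu]_(t in D) (f t)%:E <= \int[mu]_(t in D) (g t)%:E)%E.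
Proof.
move=> mD mf f0 g0 [N [mN N0 fgN]].
(* The exceptional set [N] is removed on the side of [f], where measurability is available. *)
rewrite (@ge0_negligible_integral _ _ _ mu D N)//; last first.
- exact/measurable_EFinP.
rewrite !ge0_integralE; first last.
- by move=> t [Dt _]; rewrite lee_fin f0.
- by move=> t Dt; rewrite lee_fin g0.
(* A simple function below [f] on D minus [N] is also admissible for [g] on D: off [N] the two
   agree, and on [N] it is at most 0. *)
apply: le_ereal_sup => _ [h hf <-]; exists h => // t.
apply: (le_trans (hf t)); rewrite !patchE.
case: ifPn => tDN; case: ifPn => tD //.
- move: tDN; rewrite inE => -[Dt nN].
  suff -> : f t = g t by [].
  by apply: contrapT => h'; apply: nN; apply: fgN => H; apply: h'; exact: H.
- by exfalso; move/negP: tD; apply; move: tDN; rewrite !inE => -[].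
- by rewrite lee_fin g0//; move: tD; rewrite inE.
Qed.

Lemma eq_ae_cint a b f g : cintegrable a b f -> cintegrable a b g ->
  (\forall t \ae mu, Icc a b t -> f t = g t) -> cint a b f = cint a b g.
Proof.
move=> [rf jf] [rg jg] fg; apply: complex_ext => /=; congr fine;
  (apply: ae_eq_integral; [exact: measurable_Icc|exact: (measurable_int mu)|
   exact: (measurable_int mu)|]);
  by have F := ae_filter_ringOfSetsType mu; apply: filterS fg => t tfg /tfg ->.
Qed.

Lemma sqn_ge0 f t : 0 <= sqn f t.
Proof. by rewrite /sqn addr_ge0// sqr_ge0. Qed.

Lemma measurable_sqn (D : set R) f : measurable_fun D (fun t => Re (f t)) ->
  measurable_fun D (fun t => Im (f t)) -> measurable_fun D (sqn f).
Proof. by move=> mr mi; apply: measurable_funD; exact: measurable_funX. Qed.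

Lemma L2P l f : L2 l f <-> [/\ measurable_fun (Icc 0 l) (fun t => Re (f t)),
  measurable_fun (Icc 0 l) (fun t => Im (f t)) &
  mu.-integrable (Icc 0 l) (EFin \o sqn f)].
Proof.
split.
  move=> [mr [mi i]]; split => //; apply/integrableP; split.
    by apply/measurable_EFinP; exact: measurable_sqn.
  under eq_integral do rewrite /= ger0_norm ?sqn_ge0//.
  exact: i.
move=> [mr mi /integrableP[_ i]]; split => //; split => //.
by move: i; under eq_integral do rewrite /= ger0_norm ?sqn_ge0//.
Qed.

Lemma L2_le l f (p : R -> R) : measurable_fun (Icc 0 l) (fun t => Re (f t)) ->
  measurable_fun (Icc 0 l) (fun t => Im (f t)) ->
  mu.-integrable (Icc 0 l) (EFin \o p) ->
  (forall t, 0 <= t <= l -> sqn f t <= p t) -> L2 l f.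
Proof.
move=> mr mi ip fp; apply/L2P; split => //.
apply: le_integrable ip; first exact: measurable_Icc.
  by apply/measurable_EFinP; exact: measurable_sqn.
move=> t tl /=; rewrite lee_fin ger0_norm ?sqn_ge0//.
by rewrite (le_trans (fp _ tl))// ler_norm.
Qed.

Lemma integrableZlR a b r (p : R -> R) : mu.-integrable (Icc a b) (EFin \o p) ->
  mu.-integrable (Icc a b) (EFin \o (fun t => r * p t)).
Proof. by apply: integrable_continuousM => x; exact: cvg_cst. Qed.

Lemma integrableDR a b (p u : R -> R) : mu.-integrable (Icc a b) (EFin \o p) ->
  mu.-integrable (Icc a b) (EFin \o u) ->
  mu.-integrable (Icc a b) (EFin \o (fun t => p t + u t)).
Proof.
move=> ip iu; apply: eq_integrable (integrableD _ ip iu); try exact: measurable_Icc.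
by move=> t _; rewrite /= EFinD.
Qed.

Lemma integrable_cstR a b r : mu.-integrable (Icc a b) (EFin \o (fun=> r : R)).
Proof. by apply: continuous_integrable => x; exact: cvg_cst. Qed.

(** The interval has finite measure, so 1 + |f|^2 is an integrable majorant of both components. *)
Lemma L2_cintegrable l f : L2 l f -> cintegrable 0 l f.
Proof.
move=> /L2P[mr mi i].
have i1 := integrableDR (integrable_cstR 0 l 1) i.
have le1 (p u : R) : `|p| <= `|1 + (p ^+ 2 + u ^+ 2)|.
  rewrite [leRHS]ger0_norm; last by rewrite !addr_ge0 ?sqr_ge0.
  have := sqr_ge0 (`|p| - 1); have := real_normK (num_real p).
  have := sqr_ge0 u; have := normr_ge0 p; nra.
by split; apply: le_integrable i1; [exact: measurable_Icc|exact/measurable_EFinP| |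
   exact: measurable_Icc|exact/measurable_EFinP| ];
  move=> t _; rewrite /= lee_fin /sqn; [exact: le1|rewrite [X in 1 + X]addrC; exact: le1].
Qed.

Lemma L2D l f g : L2 l f -> L2 l g -> L2 l (fun t => f t + g t).
Proof.
move=> /L2P[mrf mif jf] /L2P[mrg mig jg].
have i2 := integrableZlR 2 (integrableDR jf jg).
apply: L2_le i2 _.
- by under eq_fun do rewrite ReD; exact: measurable_funD.
- by under eq_fun do rewrite ImD; exact: measurable_funD.
- move=> t _; rewrite /sqn ReD ImD.
  have := sqr_ge0 (Re (f t) - Re (g t)); have := sqr_ge0 (Im (f t) - Im (g t)); nra.
Qed.

Lemma L2Z l z f : L2 l f -> L2 l (fun t => z * f t).
Proof.
move=> /L2P[mrf mif jf].
have i2 := integrableZlR (Re z ^+ 2 + Im z ^+ 2) jf.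
have mc r : measurable_fun (Icc 0 l) (fun=> r : R) by exact: measurable_cst.
apply: L2_le i2 _.
- by under eq_fun do rewrite ReM; apply: measurable_funB; exact: measurable_funM.
- by under eq_fun do rewrite ImM; apply: measurable_funD; exact: measurable_funM.
- by move=> t _; rewrite /sqn ReM ImM le_eqVlt; apply/orP; left; apply/eqP; ring.
Qed.

(** A primitive is continuous, hence bounded on [0, l]. *)
Lemma L2_primitive l f y : 0 <= l -> cintegrable 0 l f ->
  (forall t, 0 <= t <= l -> y t = y 0 + cint 0 t f) -> L2 l y.
Proof.
move=> l0 jf ye.
have [rf i_f] := jf; have [ry iy] := cintegrable_primitive l0 jf ye.
have cR := Rintegral_within_continuous l0 rf.
have cI := Rintegral_within_continuous l0 i_f.
have [M1 h1] := within_continuous_bounded cR.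
have [M2 h2] := within_continuous_bounded cI.
apply: (@L2_le _ _ (fun=> (`|Re (y 0)| + M1) ^+ 2 + (`|Im (y 0)| + M2) ^+ 2)).
- by apply/measurable_EFinP; exact: measurable_int ry.
- by apply/measurable_EFinP; exact: measurable_int iy.
- exact: integrable_cstR.
- move=> t tl; rewrite /sqn ye// ReD ImD.
  apply: lerD; rewrite -[leLHS]real_normK ?num_real// lerXn2r ?nnegrE//.
  + by rewrite addr_ge0// (le_trans (normr_ge0 _) (h1 _ tl)).
  + by rewrite (le_trans (ler_normD _ _))// lerD2l; exact: h1.
  + by rewrite addr_ge0// (le_trans (normr_ge0 _) (h2 _ tl)).
  + by rewrite (le_trans (ler_normD _ _))// lerD2l; exact: h2.
Qed.

(** A real-valued norm equivalent to the modulus. It avoids square roots and splits along the two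
    real integrals of [cint], while remaining submultiplicative. *)
Definition norm1 z : R := `|Re z| + `|Im z|.

Lemma norm1_ge0 z : 0 <= norm1 z. Proof. by rewrite addr_ge0. Qed.

Lemma norm1D z w : norm1 (z + w) <= norm1 z + norm1 w.
Proof.
by rewrite /norm1 ReD ImD addrACA lerD// ler_normD.
Qed.

Lemma norm1N z : norm1 (- z) = norm1 z.
Proof. by case: z => a b; rewrite /norm1 /= !normrN. Qed.

Lemma norm1M z w : norm1 (z * w) <= norm1 z * norm1 w.
Proof.
rewrite /norm1 ReM ImM.
have h1 := ler_normB (Re z * Re w) (Im z * Im w).
have h2 := ler_normD (Re z * Im w) (Im z * Re w).
apply: (le_trans (lerD h1 h2)); rewrite !normrM le_eqVlt.
by apply/orP; left; apply/eqP; ring.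
Qed.

Lemma sqn_le_norm1 f t : sqn f t <= norm1 (f t) ^+ 2.
Proof.
rewrite /sqn /norm1 -[Re _ ^+ 2]real_normK ?num_real//.
rewrite -[Im _ ^+ 2]real_normK ?num_real// sqrrD.
have : 0 <= `|Re (f t)| * `|Im (f t)| by rewrite mulr_ge0.
lra.
Qed.

Lemma norm1_le_sqn f t : norm1 (f t) ^+ 2 <= 2 * sqn f t.
Proof.
rewrite /sqn /norm1 -[X in _ <= 2 * (X + _)]real_normK ?num_real//.
rewrite -[X in _ <= 2 * (_ + X)]real_normK ?num_real//.
by move: (`|_|) (`|_|) => a b; have := sqr_ge0 (a - b); nra.
Qed.

Lemma integrable_norm1 a b f : cintegrable a b f ->
  mu.-integrable (Icc a b) (EFin \o (fun t => norm1 (f t))).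
Proof.
move=> [rf jf]; apply: integrableDR; exact: integrable_norm.
Qed.

(** The right side integrates over all of [0, l], so that the three integrals of the resolvent
    formula get bounds with a common factor. *)
Lemma norm1_cint_le a b l M k f : 0 <= a -> b <= l -> ccontinuous k ->
  cintegrable 0 l f -> (forall t, a <= t <= b -> norm1 (k t) <= M) ->
  0 <= M ->
  norm1 (cint a b (fun t => k t * f t)) <= M * \int[mu]_(t in Icc 0 l) norm1 (f t).
Proof.
move=> a0 bl ck jf kM M0.
have mI := measurable_Icc a b.
have jab : cintegrable a b f by exact: cintegrable_sub jf.
have [rk ik] := cintegrable_contM ck jab.
have n1 := integrable_norm1 jab.
have n2 := integrable_norm1 jf.
apply: (@le_trans _ _ (\int[mu]_(t in Icc a b) (M * norm1 (f t)))).
  apply: (@le_trans _ _ (\int[mu]_(t in Icc a b) norm1 (k t * f t))).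
    rewrite /norm1 RintegralD//; [|exact: integrable_norm..].
    by apply: lerD; exact: le_normr_Rintegral.
  apply: le_Rintegral => //.
  - by apply: integrable_norm1.
  - exact: integrableZlR.
  - move=> t tab; rewrite (le_trans (norm1M _ _))// ler_wpM2r ?norm1_ge0//.
    exact: kM.
rewrite RintegralZl// ler_wpM2l//.
rewrite /Rintegral fine_le//.
- by apply: integrable_fin_num.
- by apply: integrable_fin_num => //; exact: measurable_Icc.
apply: ge0_subset_integral => //.
- exact: measurable_Icc.
- exact: measurable_int n2.
- by move=> t _; rewrite lee_fin norm1_ge0.
- by move=> t /andP[at_ tb]; rewrite /Icc /= (le_trans a0)// (le_trans tb).
Qed.

(** Cauchy-Schwarz against the constant 1; the factor 2 comes from comparing [norm1] with the
    modulus. *)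
Lemma sqr_Rintegral_norm1_le l f : 0 < l -> L2 l f ->
  (\int[mu]_(t in Icc 0 l) norm1 (f t)) ^+ 2 <=
  2 * l * \int[mu]_(t in Icc 0 l) sqn f t.
Proof.
move=> l0 L2f; have mI := measurable_Icc 0 l.
have n1 := integrable_norm1 (L2_cintegrable L2f).
have /L2P[_ _ isq] := L2f.
set I := \int[mu]_(t in _) norm1 _; set N := \int[mu]_(t in _) sqn _ _.
(* [m] is the mean of [norm1] of f. Integrating (norm1 f - m)^2 >= 0 gives 2 N + m^2 l - 2 m I >= 0,
   which at this [m] is the claim. *)
pose m := I / l.
have ic := integrable_cstR 0 l (m ^+ 2).
have i1 := integrableZlR (2 * m) n1.
have i2 := integrableZlR 2 isq.
have : 0 <= \int[mu]_(t in Icc 0 l) (2 * sqn f t + m ^+ 2 - 2 * m * norm1 (f t)).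
  apply: Rintegral_ge0 => t _.
  have := norm1_le_sqn f t; have := sqr_ge0 (norm1 (f t) - m); nra.
rewrite RintegralB//; last exact: integrableDR.
rewrite RintegralD//; rewrite [X in X + _ - _]RintegralZl// [X in _ - X]RintegralZl//.
have -> : \int[mu]_(_ in Icc 0 l) m ^+ 2 = m ^+ 2 * l.
  transitivity (m ^+ 2 * fine (mu (Icc 0 l))); first exact: Rintegral_cst.
  by rewrite mu_Icc ?ltW// subr0.
rewrite -/I -/N => h.
have lI : l * m = I by rewrite /m mulrC divfK// gt_eqF.
have : 0 <= l * (2 * N + m ^+ 2 * l - 2 * m * I) by rewrite mulr_ge0// ltW.
rewrite (_ : l * _ = 2 * l * N + (l * m) ^+ 2 - 2 * (l * m) * I); last by ring.
by rewrite lI; lra.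
Qed.

End SquareIntegrable.

(* A = y''(0) and p B = p y'(0) solve a 2x2 system of determinant
   D = c2 + th (c1^2 - c0 c2); [kernel] is [s3_kernel] integrated against f. *)
Lemma boundary_elimination (K : comNzRingType)
    (th p I c0 c1 c2 x1 x2 j1 j2 jx N Q k A B B' Y : K) :
  x2 * (c1 * j1 - c0 * j2) + x1 * (c1 * j2 - c2 * j1) =
    (c1 ^+ 2 - c0 * c2) * N - k * Q ->
  B = th * B' ->
  0 = c2 * A + p * c1 * B - I * j2 ->
  p * B' = c1 * A + p * c0 * B - I * j1 ->
  p ^+ 2 * Y = x2 * A + p * x1 * B - I * jx ->
  - p ^+ 2 * (c2 + th * (c1 ^+ 2 - c0 * c2)) * Y =
  I * (c2 * jx - th * ((c1 ^+ 2 - c0 * c2) * (N - jx)) + (th * k * Q - x2 * j2)).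
Proof.
move=> kernel bc L2 L1 H2.
have e2 : p * B = th * (c1 * A + c0 * (p * B) - I * j1).
  by rewrite {1}bc mulrCA L1; ring.
have {}L2 : c2 * A + c1 * (p * B) - I * j2 = 0 by rewrite L2; ring.
pose D := c2 + th * (c1 ^+ 2 - c0 * c2).
(* Cramer's rule for A and p B, kept multiplied by [D] so that no division occurs and any
   commutative ring will do. *)
have AD : A * D = I * j2 * (1 - th * c0) + th * I * c1 * j1.
  apply/eqP; rewrite -subr_eq0; apply/eqP.
  transitivity ((1 - th * c0) * (c2 * A + c1 * (p * B) - I * j2)
     - c1 * (p * B - th * (c1 * A + c0 * (p * B) - I * j1))).
    by rewrite /D; ring.
  by rewrite -e2 L2 subrr !mulr0 subr0.
have BD : (p * B) * D = th * I * (c1 * j2 - c2 * j1).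
  apply/eqP; rewrite -subr_eq0; apply/eqP.
  transitivity (c2 * (p * B - th * (c1 * A + c0 * (p * B) - I * j1))
     + th * c1 * (c2 * A + c1 * (p * B) - I * j2)).
    by rewrite /D; ring.
  by rewrite -e2 L2 subrr !mulr0 addr0.
transitivity (- (x2 * (A * D) + x1 * (p * B * D) - I * jx * D)).
  transitivity (- (D * (p ^+ 2 * Y))); first by rewrite /D; ring.
  by rewrite H2; ring.
rewrite AD BD.
transitivity (I * (c2 * jx + th * (c1 ^+ 2 - c0 * c2) * jx - x2 * j2) -
   I * th * (x2 * (c1 * j1 - c0 * j2) + x1 * (c1 * j2 - c2 * j1))).
  by rewrite /D; ring.
by rewrite kernel; ring.
Qed.

(** * The Green formula for the boundary value problem *)

Section Resolvent.
Context {R : realType}.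
Local Notation mu := (@lebesgue_measure R).
Local Notation om := (@zeta R 1).
Variables (l : R) (theta lam : R[i]).
Hypotheses (l0 : 0 < l) (lam0 : lam != 0) (D0 : Delta l theta lam != 0).
Implicit Types (t x : R) (f g y : R -> R[i]).

Local Notation q := (cI * lam).

Lemma q_sqr : q ^+ 2 = - lam ^+ 2.
Proof. by rewrite exprMn cI_sqr mulN1r. Qed.

(** The right-hand side of the resolvent formula, kept literally so that results about it yield the
    final statement by conversion. *)
Definition green x f :=
  cI / (lam ^+ 4 * Delta l theta lam) *
  (cint 0 x (fun t => s3 2 (cI * lam * (x - t)%:C%C) * s3 2 (cI * lam * l%:C%C) * f t)
   - theta * cint x l (fun t => s3 2 (cI * lam * (x - t)%:C%C)
                                 * s3 2 (- (cI * lam * l%:C%C)) * f t)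
   + cint 0 l (fun t => (theta * s3 2 (cI * lam * (x - l)%:C%C) * s3 2 (- (cI * lam * t%:C%C))
                         - s3 2 (cI * lam * x%:C%C) * s3 2 (cI * lam * (l - t)%:C%C)) * f t)).

Lemma s3_continuous k x : ccontinuous (fun t => s3 k (q * (x - t)%:C%C)).
Proof.
have cE m : ccontinuous (fun t => expw (q * zeta m) x * expw (- (q * zeta m)) t).
  by apply: ccontinuousM; [exact: ccontinuous_cst|exact: expw_continuous].
rewrite (_ : (fun t => _) = (fun t => 3^-1 * (expw (q * zeta 0) x * expw (- (q * zeta 0)) t
   + om ^- k * (expw (q * zeta 1) x * expw (- (q * zeta 1)) t)
   + (zeta 2) ^- k * (expw (q * zeta 2) x * expw (- (q * zeta 2)) t)))).
  apply: ccontinuousM; first exact: ccontinuous_cst.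
  apply: ccontinuousD; last by apply: ccontinuousM => //; exact: ccontinuous_cst.
  by apply: ccontinuousD => //; apply: ccontinuousM => //; exact: ccontinuous_cst.
by apply/funext => t; rewrite s3E -!cexp_zeta zeta0 mulr1.
Qed.

Lemma s3N_continuous k : ccontinuous (fun t => s3 k (- (q * t%:C%C))).
Proof.
rewrite (_ : (fun t => _) = (fun t => s3 k (q * (0 - t)%:C%C))); first exact: s3_continuous.
by apply/funext => t; rewrite sub0r rmorphN mulrN.
Qed.

Lemma green_kernel x t :
  s3 2 (q * x%:C%C) * (s3 1 (q * l%:C%C) * s3 1 (q * (l - t)%:C%C)
    - s3 0 (q * l%:C%C) * s3 2 (q * (l - t)%:C%C)) +
  s3 1 (q * x%:C%C) * (s3 1 (q * l%:C%C) * s3 2 (q * (l - t)%:C%C)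
    - s3 2 (q * l%:C%C) * s3 1 (q * (l - t)%:C%C)) =
  s3 2 (- (q * l%:C%C)) * s3 2 (q * (x - t)%:C%C)
    - s3 2 (q * (x - l)%:C%C) * s3 2 (- (q * t%:C%C)).
Proof.
have qB a b : q * (a - b)%:C%C = q * a%:C%C - q * b%:C%C by rewrite rmorphB mulrBr.
by rewrite !qB; exact: s3_kernel.
Qed.

(** Variation of constants at x and at l, combined with the boundary conditions, is exactly the
    linear system of [boundary_elimination]. *)
Lemma green_primitives y y1 y2 g f x : cintegrable 0 l f -> cintegrable 0 l g ->
  primitives l y y1 y2 g -> (forall t, g t = - cI * f t + q ^+ 3 * y t) ->
  y 0 = 0 -> y1 0 = theta * y1 l -> y l = 0 -> 0 <= x <= l -> y x = green x f.
Proof.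
move=> jf jg prim ge y00 bc yl0 /andP[x0 xl].
have cs := s3_continuous; have csN := s3N_continuous.
have cc z := ccontinuous_cst z.
have jf' x' : x' <= l -> cintegrable 0 x' f.
  by move=> ?; exact: cintegrable_sub jf.
pose J1 a := cint 0 a (fun t => s3 1 (q * (a - t)%:C%C) * f t).
pose J2 a := cint 0 a (fun t => s3 2 (q * (a - t)%:C%C) * f t).
pose N := cint 0 l (fun t => s3 2 (q * (x - t)%:C%C) * f t).
pose Q := cint 0 l (fun t => s3 2 (- (q * t%:C%C)) * f t).
have jN : cintegrable 0 l (fun t => s3 2 (q * (x - t)%:C%C) * f t).
  by apply: cintegrable_contM.
have jQ : cintegrable 0 l (fun t => s3 2 (- (q * t%:C%C)) * f t).
  by apply: cintegrable_contM.
have jJ k : cintegrable 0 l (fun t => s3 k (q * (l - t)%:C%C) * f t).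
  by apply: cintegrable_contM.
(* [T1], [T2], [T3] express the three integrals of [green] through [J2], [N] and [Q]; the integral
   over [x, l] is the difference of those over [0, l] and [0, x]. *)
have T1 : cint 0 x (fun t => s3 2 (q * (x - t)%:C%C) * s3 2 (q * l%:C%C) * f t) =
    s3 2 (q * l%:C%C) * J2 x.
  rewrite -cintZ; last by apply: cintegrable_contM => //; exact: jf'.
  by apply: eq_cint => t _; ring.
have T2 : cint x l (fun t => s3 2 (q * (x - t)%:C%C) * s3 2 (- (q * l%:C%C)) * f t) =
    s3 2 (- (q * l%:C%C)) * (N - J2 x).
  rewrite /N (cint_cat x0 xl jN) [J2 x + _]addrC addrK -cintZ; last exact: cintegrable_sub jN.
  by apply: eq_cint => t _; ring.
have T3 : cint 0 l (fun t => (theta * s3 2 (q * (x - l)%:C%C) * s3 2 (- (q * t%:C%C))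
     - s3 2 (q * x%:C%C) * s3 2 (q * (l - t)%:C%C)) * f t) =
    theta * s3 2 (q * (x - l)%:C%C) * Q - s3 2 (q * x%:C%C) * J2 l.
  rewrite /J2 /Q -cintZ// -cintZ// -cintB; [|exact: cintegrableZ..].
  by apply: eq_cint => t _; ring.
(* [green_kernel] integrated against [f], after collecting the coefficients [a] of [J1 l] and [b] of
   [J2 l]. *)
have K : s3 2 (q * x%:C%C) * (s3 1 (q * l%:C%C) * J1 l - s3 0 (q * l%:C%C) * J2 l) +
    s3 1 (q * x%:C%C) * (s3 1 (q * l%:C%C) * J2 l - s3 2 (q * l%:C%C) * J1 l) =
    s3 2 (- (q * l%:C%C)) * N - s3 2 (q * (x - l)%:C%C) * Q.
  pose a := s3 2 (q * x%:C%C) * s3 1 (q * l%:C%C) - s3 1 (q * x%:C%C) * s3 2 (q * l%:C%C).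
  pose b := s3 1 (q * x%:C%C) * s3 1 (q * l%:C%C) - s3 2 (q * x%:C%C) * s3 0 (q * l%:C%C).
  transitivity (a * J1 l + b * J2 l); first by rewrite /a /b; ring.
  rewrite -[- (_ * Q)]mulNr /J1 /J2 /N /Q -!cint_lin2//.
  apply: eq_cint => t _; have := green_kernel x t; rewrite /a /b.
  move=> /eqP; rewrite -subr_eq0 => /eqP k.
  by apply: subr0_eq; rewrite -[RHS](mul0r (f t)) -k; ring.
have [H2 _] := duhamel l0 jg prim ge (introT andP (conj x0 xl)).
have l00 : 0 <= l <= l by rewrite ltW /=.
have [Y2 Y1] := duhamel l0 jg prim ge l00.
have [_ _ sN] := s3_opp (q * l%:C%C).
move: H2 Y2 Y1; rewrite -/(J2 l) -/(J1 l) -/(J2 x) y00 yl0 !mulr0 !addr0 => H2 L2 L1.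
rewrite /green T1 T2 T3.
(* The denominator lam^4 Delta equals -q^2 times the determinant of the boundary system; clearing it
   leaves an identity without division. *)
have n4 : lam ^+ 4 * Delta l theta lam != 0 by rewrite mulf_neq0// expf_neq0.
apply: (mulfI n4); rewrite [RHS]mulrA [_ * (cI / _)]mulrC divfK//.
have DE : lam ^+ 4 * Delta l theta lam =
    lam ^+ 2 * (s3 2 (q * l%:C%C) + theta * s3 2 (- (q * l%:C%C))).
  by rewrite /Delta -[4%N]/(2 + 2)%N exprD -mulrA mulVKf// expf_neq0.
rewrite DE -[lam ^+ 2]opprK -q_sqr.
move: K bc L2 L1 H2; rewrite sN.
exact: boundary_elimination.
Qed.

(** Shooting: the free initial data y'(0) and y''(0) are chosen so that the two conditions involving
    l hold. *)
Lemma green_primitives_exists f : cintegrable 0 l f ->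
  exists y y1 y2 : R -> R[i],
    [/\ primitives l y y1 y2 (fun t => - cI * f t + q ^+ 3 * y t),
        y 0 = 0, y1 0 = theta * y1 l & y l = 0] /\ cintegrable 0 l y.
Proof.
move=> jf.
have l00 : 0 <= l <= l by rewrite ltW /=.
have nq : q != 0 by exact: q_neq0.
pose j1 := cint 0 l (fun t => s3 1 (q * (l - t)%:C%C) * f t).
pose j2 := cint 0 l (fun t => s3 2 (q * (l - t)%:C%C) * f t).
pose c0 := s3 0 (q * l%:C%C); pose c1 := s3 1 (q * l%:C%C); pose c2 := s3 2 (q * l%:C%C).
pose D := c2 + theta * (c1 ^+ 2 - c0 * c2).
(* Expanding s_2(-q l) by [s3_opp] shows that [D] is lam^2 Delta. *)
have nD : D != 0.
  have [_ _ sN] := s3_opp (q * l%:C%C).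
  rewrite /D /c0 /c1 /c2 -sN; move: D0; rewrite /Delta.
  by rewrite mulf_eq0 negb_or => /andP[].
(* Cramer's solution of the boundary system. The unknown there is q y'(0), whence the extra q in the
   denominator of [B]. *)
pose A := (cI * j2 * (1 - theta * c0) + theta * cI * c1 * j1) / D.
pose B := theta * cI * (c1 * j2 - c2 * j1) / (q * D).
have [y [y1 [y2 [[prim jy] y00 y10 y20]]]] := duhamel_exists l0 lam0 A B jf.
exists y, y1, y2.
have jg : cintegrable 0 l (fun t => - cI * f t + q ^+ 3 * y t).
  by apply: cintegrableD; exact: cintegrableZ.
have [Y2 Y1] := duhamel l0 jg prim (fun t => erefl) l00.
move: Y2 Y1; rewrite !(y00, y10, y20, mulr0, addr0) -/j1 -/j2 -/c0 -/c1 -/c2 => Y2 Y1.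
have nD' : c2 + theta * (c1 ^+ 2 - c0 * c2) != 0 := nD.
split=> //; split => //.
- apply: (mulfI nq); rewrite [RHS]mulrCA Y1 /A /B /D.
  by field; rewrite nD' lam0 cI_neq0.
- apply: (mulfI (expf_neq0 2 nq)); rewrite Y2 mulr0 /A /B /D.
  by field; rewrite nD' lam0 cI_neq0.
Qed.

(** The interval [-l, l] contains every real argument of s_2 that occurs in [green]. *)
Lemma s3_norm1_bounded : exists2 M : R, 0 <= M &
  forall s, - l <= s <= l -> norm1 (s3 2 (q * s%:C%C)) <= M.
Proof.
have [c1 c2] := s3N_continuous 2.
have [M1 h1] := within_continuous_bounded (@continuous_subspaceT _ _ `[- l, l]%classic _ c1).
have [M2 h2] := within_continuous_bounded (@continuous_subspaceT _ _ `[- l, l]%classic _ c2).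
exists (`|M1| + `|M2|) => [|s sl]; first exact: addr_ge0.
have sl' : - l <= - s <= l by rewrite lerN2 lerNl andbC.
have := h1 _ sl'; have := h2 _ sl'; rewrite rmorphN mulrN opprK => a b.
by rewrite /norm1 lerD// (le_trans _ (ler_norm _)).
Qed.

Lemma green_bounded : exists2 C : R, 0 <= C & forall f x, cintegrable 0 l f ->
  0 <= x <= l -> norm1 (green x f) <= C * \int[mu]_(t in Icc 0 l) norm1 (f t).
Proof.
have [M M0 hM] := s3_norm1_bounded.
set c := cI / (lam ^+ 4 * Delta l theta lam).
pose T := norm1 theta; have T0 : 0 <= T := norm1_ge0 theta.
(* One summand for each integral of [green]: [M] bounds every factor s_2 and [T] is the norm of
   [theta]. *)
exists (norm1 c * (M * M + T * (M * M) + (T * M * M + M * M))).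
  by rewrite !(mulr_ge0, addr_ge0)// norm1_ge0.
move=> f x jf /andP[x0 xl].
have cs := s3_continuous 2; have csN := s3N_continuous 2.
have cc z : ccontinuous (fun=> z : R[i]) := ccontinuous_cst z.
set I := \int[mu]_(t in _) _.
have I0 : 0 <= I by apply: Rintegral_ge0 => t _; exact: norm1_ge0.
have nM z w : norm1 z <= M -> norm1 w <= M -> norm1 (z * w) <= M * M.
  by move=> zM wM; rewrite (le_trans (norm1M _ _))// ler_pM// norm1_ge0.
have hN s : - l <= s <= l -> norm1 (s3 2 (- (q * s%:C%C))) <= M.
  move=> sl; have := hM (- s); rewrite rmorphN mulrN; apply.
  by rewrite lerN2 lerNl andbC.
have ll : - l <= l <= l by rewrite lexx andbT (le_trans _ (ltW l0))// oppr_le0 ltW.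
rewrite /green -/c; apply: (le_trans (norm1M _ _)); rewrite -[leRHS]mulrA.
apply: ler_wpM2l; first exact: norm1_ge0.
rewrite (le_trans (norm1D _ _))// [leRHS]mulrDl; apply: lerD.
  rewrite (le_trans (norm1D _ _))// [leRHS]mulrDl; apply: lerD.
    apply: (norm1_cint_le (lexx 0) xl) => //; last exact: mulr_ge0.
      by apply: ccontinuousM.
    by move=> t /andP[t0 tx]; apply: nM; apply: hM => //; lra.
  rewrite norm1N; apply: (le_trans (norm1M _ _)); rewrite -[leRHS]mulrA.
  apply: ler_wpM2l => //.
  apply: (norm1_cint_le x0 (lexx l)) => //; last exact: mulr_ge0.
    by apply: ccontinuousM.
  by move=> t /andP[tx tl]; apply: nM; [apply: hM|apply: hN] => //; lra.
apply: (norm1_cint_le (lexx 0) (lexx l)) => //.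
- apply: ccontinuousB; first by apply: ccontinuousM => //; exact: ccontinuous_cst.
  by apply: ccontinuousM.
- move=> t /andP[t0 tl]; rewrite (le_trans (norm1D _ _))// norm1N lerD//.
    rewrite -[X in norm1 X]mulrA -[leRHS]mulrA; apply: (le_trans (norm1M _ _)); apply: ler_wpM2l => //.
    by apply: nM; [apply: hM|apply: hN]; lra.
  by apply: nM; apply: hM; lra.
- by rewrite !(mulr_ge0, addr_ge0).
Qed.

End Resolvent.

(** * The graph of the operator and the bounded inverse *)

Section Graph.
Context {R : realType}.
Local Notation mu := (@lebesgue_measure R).
Variables (l : R) (theta lam : R[i]).
Hypotheses (l0 : 0 < l) (lam0 : lam != 0) (D0 : Delta l theta lam != 0).
Implicit Types (t x : R) (f g h y : R -> R[i]).

(** The source attached to a graph element is known only almost everywhere, so the formula must not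
    see null sets. *)
Lemma eq_ae_green f g x : cintegrable 0 l f -> cintegrable 0 l g ->
  ae_eqI l f g -> 0 <= x <= l -> green l theta lam x f = green l theta lam x g.
Proof.
move=> jf jg fg /andP[x0 xl].
have E a b k : 0 <= a -> b <= l -> ccontinuous k ->
    cint a b (fun t => k t * f t) = cint a b (fun t => k t * g t).
  move=> a0 bl ck; apply: eq_ae_cint.
  - by apply: cintegrable_contM => //; exact: cintegrable_sub jf.
  - by apply: cintegrable_contM => //; exact: cintegrable_sub jg.
  - have F := ae_filter_ringOfSetsType mu; apply: filterS fg => t tfg /andP[at_ tb].
    by rewrite tfg// /Icc /= (le_trans a0 at_) (le_trans tb bl).
have cs := s3_continuous lam 2; have csN := s3N_continuous lam 2.
have cc z : ccontinuous (fun=> z : R[i]) := ccontinuous_cst z.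
rewrite /green; congr (_ * (_ - _ * _ + _)); apply: E => //.
- by apply: ccontinuousM.
- by apply: ccontinuousM.
- by apply: ccontinuousB; apply: ccontinuousM => //; exact: ccontinuousM.
Qed.

Lemma green0 x : green l theta lam x (fun=> 0) = 0.
Proof.
have z a b k : cint a b (fun t => k t * 0 : R[i]) = 0.
  rewrite (@eq_cint _ _ _ _ (fun=> 0 * 0)); last by move=> t _; rewrite !mulr0.
  rewrite (@cintZ _ a b 0 (fun=> 0)) ?mul0r//.
  by apply: ccontinuous_integrable; exact: ccontinuous_cst.
by rewrite /green !z !(mulr0, subr0, addr0).
Qed.

(** The function [h] need not be measurable. The substitute i g - lam^3 y, with [g] the third
    derivative from the graph, lies in L^2 and satisfies the equation at every point, as q^3 = -i
    lam^3. *)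
Lemma L_graph_source y h : L_graph l theta y h ->
  exists f, [/\ L2 l f, L2 l y, ae_eqI l (fun t => h t - lam ^+ 3 * y t) f &
    forall x, 0 <= x <= l -> y x = green l theta lam x f].
Proof.
move=> [y1 [y2 [g [Lg [prim [[y00 bc yl0] hg]]]]]].
have jg := L2_cintegrable Lg.
have [_ j1 jy] := primitives_integrable l0 jg prim.
have Ly : L2 l y by apply: (L2_primitive (ltW l0) j1) => t /prim[].
exists (fun t => cI * g t - lam ^+ 3 * y t).
have Lf : L2 l (fun t => cI * g t - lam ^+ 3 * y t).
  have := L2D (L2Z cI Lg) (L2Z (- lam ^+ 3) Ly).
  by under eq_fun do rewrite mulNr.
split=> //.
  have F := ae_filter_ringOfSetsType mu.
  by apply: filterS hg => t hgt /hgt ->.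
move=> x xl; apply: (green_primitives l0 lam0 D0 (L2_cintegrable Lf) jg prim) => //.
by move=> t; ring: (@cI_sqr R).
Qed.

Lemma L_graph_green y h f x : L_graph l theta y h -> L2 l f ->
  ae_eqI l (fun t => h t - lam ^+ 3 * y t) f -> 0 <= x <= l ->
  y x = green l theta lam x f.
Proof.
move=> /L_graph_source[f' [Lf' _ hf' yE]] Lf hf xl; rewrite yE//.
apply: eq_ae_green => //; try exact: L2_cintegrable.
have F := ae_filter_ringOfSetsType mu.
by apply: filterS2 hf hf' => t ht ht' tl; rewrite -ht// -ht'.
Qed.

Lemma L_graph_exists f : L2 l f -> exists y h, L_graph l theta y h /\
  ae_eqI l (fun t => h t - lam ^+ 3 * y t) f.
Proof.
move=> Lf; have jf := L2_cintegrable Lf.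
have [y [y1 [y2 [[prim y00 bc yl0] jy]]]] := green_primitives_exists l0 lam0 D0 jf.
(* This third derivative makes i g - lam^3 y equal to [f] at every point. *)
pose g t := - cI * f t + (cI * lam) ^+ 3 * y t.
have jg : cintegrable 0 l g by apply: cintegrableD; exact: cintegrableZ.
have [_ j1 _] := primitives_integrable l0 jg prim.
have Ly : L2 l y by apply: (L2_primitive (ltW l0) j1) => t /prim[].
exists y, (fun t => cI * g t); split.
  exists y1, y2, g; split; first by apply: L2D; exact: L2Z.
  by split => //; split => //; exact: aeW.
by apply: aeW => t _; rewrite /g; ring: (@cI_sqr R).
Qed.

Lemma L_graph_bounded : exists K : R, forall y h, L_graph l theta y h ->
  (\int[mu]_(t in Icc 0 l) (sqn y t)%:E <=
   K%:E * \int[mu]_(t in Icc 0 l) (sqn (fun s => h s - lam ^+ 3 * y s) t)%:E)%E.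
Proof.
have [C C0 hC] := green_bounded theta lam l0.
(* C^2 comes from the pointwise bound on [green], 2 l from Cauchy-Schwarz, and the last l from
   integrating a constant over [0, l]. *)
exists (C ^+ 2 * (2 * l) * l) => y h /L_graph_source[f [Lf Ly hf yE]].
have mI := measurable_Icc 0 l.
have [/L2P[mrf mif jf] /L2P[mry miy jy]] := (Lf, Ly).
set K := C ^+ 2 * (2 * l) * l.
have K0 : 0 <= K by rewrite !mulr_ge0// ?sqr_ge0// ltW.
(* The measurable source [f] replaces h - lam^3 y, with which it agrees almost everywhere. *)
apply: (@le_trans _ _ (K%:E * \int[mu]_(t in Icc 0 l) (sqn f t)%:E)%E); last first.
  apply: lee_wpmul2l; first by rewrite lee_fin.
  apply: ge0_ae_le_integral => //.
  - exact: measurable_sqn.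
  - by move=> t _; exact: sqn_ge0.
  - by move=> t _; exact: sqn_ge0.
  - have F := ae_filter_ringOfSetsType mu.
    by apply: filterS hf => t ht /ht; rewrite /sqn => ->.
set N := \int[mu]_(t in Icc 0 l) sqn f t.
have -> : (\int[mu]_(t in Icc 0 l) (sqn f t)%:E)%E = N%:E.
  by rewrite /N /Rintegral fineK//; apply: integrable_fin_num.
have yN t : 0 <= t <= l -> sqn y t <= C ^+ 2 * (2 * l) * N.
  move=> tl; apply: (le_trans (sqn_le_norm1 y t)).
  have := hC f t (L2_cintegrable Lf) tl; rewrite -yE// => yC.
  have C2 : norm1 (y t) ^+ 2 <= (C * \int[mu]_(t in Icc 0 l) norm1 (f t)) ^+ 2.
    rewrite lerXn2r ?nnegrE ?norm1_ge0// mulr_ge0//.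
    by apply: Rintegral_ge0 => s _; exact: norm1_ge0.
  apply: (le_trans C2); rewrite exprMn -[leRHS]mulrA ler_wpM2l ?sqr_ge0//.
  exact: sqr_Rintegral_norm1_le.
apply: (@le_trans _ _ (\int[mu]_(t in Icc 0 l) (C ^+ 2 * (2 * l) * N)%:E)%E).
  apply: ge0_le_integral => //.
  - by move=> t _; rewrite lee_fin sqn_ge0.
  - exact: (measurable_int mu).
rewrite (_ : \int[mu]_(t in Icc 0 l) _ = (C ^+ 2 * (2 * l) * N)%:E * mu (Icc 0 l))%E;
  last exact: integral_cst.
rewrite (mu_Icc (ltW l0)) subr0.
by rewrite -!EFinM lee_fin /K le_eqVlt; apply/orP; left; apply/eqP; ring.
Qed.

End Graph.

Theorem theorem9p1 (R : realType) (l : R) (theta lam : R[i]) :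
  0 < l -> Re theta ^+ 2 + Im theta ^+ 2 = 1 -> theta != -1 ->
  lam != 0 -> Delta l theta lam != 0 ->
  in_resolvent l theta (lam ^+ 3) /\
  (forall f : R -> R[i], L2 l f ->
   forall y h : R -> R[i], L_graph l theta y h ->
     ae_eqI l (fun t => h t - lam ^+ 3 * y t) f ->
   forall x : R, 0 <= x <= l ->
     y x = cI / (lam ^+ 4 * Delta l theta lam) *
       (cint 0 x (fun t => s3 2 (cI * lam * (x - t)%:C%C) * s3 2 (cI * lam * l%:C%C) * f t)
        - theta * cint x l (fun t => s3 2 (cI * lam * (x - t)%:C%C)
                                      * s3 2 (- (cI * lam * l%:C%C)) * f t)
        + cint 0 l (fun t => (theta * s3 2 (cI * lam * (x - l)%:C%C) * s3 2 (- (cI * lam * t%:C%C))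
                              - s3 2 (cI * lam * x%:C%C) * s3 2 (cI * lam * (l - t)%:C%C)) * f t))).
Proof.
move=> l0 _ _ lam0 D0; split; last first.
  by move=> f Lf y h yh hf x xl; exact: L_graph_green yh Lf hf xl.
split.
- by move=> f Lf; exact: L_graph_exists.
(* With source zero the formula gives y = 0 at every point of [0, l]; the zero function enters L^2
   as a multiple of y. *)
- move=> y h yh hy; have [_ [_ Ly _ _]] := L_graph_source l0 lam0 D0 yh.
  have L0 : L2 l (fun=> 0) by have := L2Z 0 Ly; under eq_fun do rewrite mul0r.
  apply: aeW => t tl; rewrite -(green0 l theta lam t).
  exact: L_graph_green yh L0 hy tl.
- exact: L_graph_bounded.
Qed.
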